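(* Let $d=1$, let $(\sigma_*,\sigma^* )\subset\mathbb{R}$ be an open interval containing $[0,1]$, and let $b:[0,\infty)\times(\sigma_*,\sigma^* )\times\mathbb{R}\to\mathbb{R}$, written $b(t,\sigma,x)$, satisfy assumption (B) of the context and be strictly increasing in $\sigma$ in the sense that $\partial_\sigma b>0$. Let $f(\xi)=1$ for $\xi<0$, $f(\xi)=0$ for $\xi\ge0$, and $\sigma_0(m)=f\big(\int_{\mathbb{R}}x\,dm(x)\big)$. Fix $t>0$. Let $\tilde\mu$ and $\tilde\nu$ be compactly supported probability measures on $\mathbb{R}$ such that $$\operatorname{supp}\tilde\mu\subset(-\infty,0],\qquad\operatorname{supp}\tilde\nu\subset[c,\infty)$$ for some $c>0$, and $\int x\,d\tilde\mu(x)<0$. Let $\lambda\in(0,1)$ be chosen such that $\int_{\mathbb{R}}x\,d\big((1-\lambda)\tilde\mu+\lambda\tilde\nu\big)(x)=0$. Set $\mu=x(t,0,0,\cdot)_\sharp\tilde\mu$, $\nu=x(t,0,1,\cdot)_\sharp\tilde\nu$ and $m=(1-\lambda)\mu+\lambda\nu$. Then there exist an infinite sequence of integers $N_k\to\infty$, points $\bm{x}_k=(x_1,\dots,x_{N_k})\in\mathbb{R}^{N_k}$ (depending on $k$) with $W_2\big(\mu^{N_k}_{\bm{x}_k},m\big)\to0$, and integers $1<J_k<N_k$ with $J_k/N_k\to\lambda$, such that for $N=N_k$, $J=J_k$ there are at least three solutions $(\sigma_1,\dots,\sigma_N)$ of the $N$-player Nash equilibrium condition $$\sigma_i=\sigma_0\left(\frac1{N-1}\sum_{j\ne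 i}\delta_{x(0,t,\sigma_j,x_j)}\right),\qquad i=1,\dots,N,$$ which are given by (1) $\sigma_i=0$ for $i=1,\dots,N$; (2) $\sigma_i=1$ for $i=1,\dots,N$; and (3) $\sigma_i=1$ for $i=1,\dots,J$ and $\sigma_i=0$ for $i=J+1,\dots,N$.
   Context: Assumption (B): $b$ is continuous, continuously differentiable in $(\sigma,x)$; there are constants $M_b,L_b$ with $|b|\le M_b$ and $|D_xb|\le L_b$ everywhere; for each $T>0$, $b$ is Hölder continuous in $t\in[0,T]$ uniformly in $(\sigma,x)$; and $B(t,\sigma,x):=\int_0^\sigma b(t,u,x)\,du$ satisfies $|D^2_{xx}B|\le H_B$ everywhere for some constant $H_B$. For $s,t\ge0$, $\sigma\in(\sigma_*,\sigma^* )$, $x\in\mathbb{R}$, $s\mapsto x(s,t,\sigma,x)$ denotes the unique solution of $\dot x(s)=b(s,\sigma,x(s))$ with $x(t)=x$; thus $x(t,0,\sigma,\cdot)$ is the flow from time $0$ to time $t$ and $x(0,t,\sigma,\cdot)$ is its inverse. $g_\sharp m$ is the push-forward of $m$ by $g$. $\mu^N_{\bm{x}}=\frac1N\sum_{j=1}^N\delta_{x_j}$. $W_2$ is the 2-Wasserstein distance. *)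

(* Defs.v *)
From HB Require Import structures.
From mathcomp Require Import all_boot all_order all_algebra.
From mathcomp Require Import all_classical all_reals all_analysis.
Set Implicit Arguments.
Unset Strict Implicit.
Unset Printing Implicit Defensive.
Import Order.TTheory GRing.Theory Num.Theory.
Import numFieldNormedType.Exports.
Local Open Scope classical_set_scope.
Local Open Scope ring_scope.

Section Measures.
Context {R : realType}.
Local Notation T := (measurableTypeR R).

Definition msupport (mu : set T -> \bar R) : set R :=
  [set x | forall U : set R, open U -> U x -> (0 < mu U)%E].

(* mu and nu are bare set functions so that this applies to the pushforward by
   a map not yet known to be measurable, such as a flow map. *)
Definition mix (l : R) (mu nu : set T -> \bar R) : set T -> \bar R :=
  fun A => ((1 - l)%:E * mu A + l%:E * nu A)%E.

(* The points are listed with multiplicity; the weight is 1 / size s. *)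
Definition empirical (s : seq R) : {measure set T -> \bar R} :=
  mscale ((size s)%:R^-1)%:nng (msum (fun k => \d_(s`_k : T)) (size s)).

(* The marginal conditions are restricted to measurable sets: measures are
   unconstrained elsewhere. *)
Definition is_coupling (mu nu : set T -> \bar R)
    (pi : probability (T * T)%type R) : Prop :=
  forall A : set T, measurable A ->
    pi (A `*` setT) = mu A /\ pi (setT `*` A) = nu A.

Definition W2 (mu nu : set T -> \bar R) : \bar R :=
  (ereal_inf [set (\int[pi]_z (`|z.1 - z.2| ^+ 2)%:E)%E
              | pi in is_coupling mu nu] `^ 2^-1)%E.

End Measures.

Section Drift.
Context {R : realType}.
Implicit Types (lo hi : \bar R) (b : R -> R -> R -> R).

(* The endpoints may be infinite. *)
Definition oitv lo hi : set R := [set s | (lo < s%:E)%E /\ (s%:E < hi)%E].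

Definition Dsigma b (t s x : R) : R := derive1 (fun s' => b t s' x) s.
Definition Dx b (t s x : R) : R := derive1 (fun x' => b t s x') x.

Definition oriented_int (f : R -> R) (u v : R) : R :=
  if u <= v then \int[lebesgue_measure]_(r in `[u, v]) f r
  else - \int[lebesgue_measure]_(r in `[v, u]) f r.

Definition primB b (t s x : R) : R := oriented_int (fun u => b t u x) 0 s.

(* b is total; only its values for t >= 0 and s in ]lo, hi[ are constrained. *)
Record assumptionB lo hi b : Prop := AssumptionB {
  B_continuous :
    {within [set p : R * R * R | 0 <= p.1.1 /\ oitv lo hi p.1.2],
      continuous (fun p : R * R * R => b p.1.1 p.1.2 p.2)} ;
  B_C1 : forall t s x : R, 0 <= t -> oitv lo hi s ->
    [/\ derivable (fun s' => b t s' x) s 1,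
        derivable (fun x' => b t s x') x 1,
        {for (s, x), continuous (fun p : R * R => Dsigma b t p.1 p.2)} &
        {for (s, x), continuous (fun p : R * R => Dx b t p.1 p.2)}] ;
  B_bounded : exists M : R, forall t s x : R, 0 <= t -> oitv lo hi s ->
    `|b t s x| <= M ;
  B_Dx_bounded : exists L : R, forall t s x : R, 0 <= t -> oitv lo hi s ->
    `|Dx b t s x| <= L ;
  B_holder : forall T : R, 0 < T ->
    exists alpha C : R, 0 < alpha <= 1 /\
      forall t t' s x : R, 0 <= t <= T -> 0 <= t' <= T -> oitv lo hi s ->
        `|b t s x - b t' s x| <= C * `|t - t'| `^ alpha ;
  B_D2B_bounded : exists H : R, forall t s x : R, 0 <= t -> oitv lo hi s ->
    [/\ derivable (primB b t s) x 1,
        derivable (derive1 (primB b t s)) x 1 &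
        `|derive1n 2 (primB b t s) x| <= H]
}.

(* Derivative relative to the set D, hence one-sided at a boundary point. *)
Definition is_derive_within (D : set R) (f : R -> R) (s l : R) : Prop :=
  (f r - f s) / (r - s) @[r --> within D s^'] --> l.

(* X s t sigma x is the value at time s of the solution passing through x at
   time t; assumptionB (bounded Dx) makes X unique for s, t >= 0. *)
Definition is_flow lo hi b (X : R -> R -> R -> R -> R) : Prop :=
  forall t sigma x : R, 0 <= t -> oitv lo hi sigma ->
    X t t sigma x = x /\
    forall s : R, 0 <= s ->
      is_derive_within [set r | 0 <= r] (fun r => X r t sigma x) s
        (b s sigma (X s t sigma x)).

End Drift.

Section Game.
Context {R : realType}.

Definition threshold (xi : R) : R := if xi < 0 then 1 else 0.

Definition sigma0 (m : {measure set (measurableTypeR R) -> \bar R}) : R :=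
  threshold (\int[m]_x x).

(* The list of the indices j != i has size N - 1, which normalizes the measure
   by 1 / (N - 1). *)
Definition is_nash (X : R -> R -> R -> R -> R) (t : R) (N : nat)
    (x sigma : 'rV[R]_N) : Prop :=
  forall i : 'I_N, sigma 0 i =
    sigma0 (empirical [seq X 0 t (sigma 0 j) (x 0 j) | j <- enum 'I_N & j != i]).

End Game.

(* Main.v *)
Require Import Defs.
From HB Require Import structures.
From mathcomp Require Import all_boot all_order all_algebra.
From mathcomp Require Import all_classical all_reals all_analysis.
From mathcomp Require Import measurable_realfun ring lra.
Set Implicit Arguments.
Unset Strict Implicit.
Unset Printing Implicit Defensive.
Import Order.TTheory GRing.Theory Num.Theory.
Import numFieldNormedType.Exports.
Local Open Scope classical_set_scope.
Local Open Scope ring_scope.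

(** Write Phi for the flow with parameter 0 on ]-oo, 0] and for the flow with
    parameter 1 on ]0, +oo[.  Since [tmu] and [tnu] are separated by ]0, c[,
    the measure [m] is the image under Phi of M = (1 - lam) tmu + lam tnu, and
    Phi is Lipschitz off the gap ]0, c[.  Let Q be the quantile function of M.
    Take y_i = Q (1 - i / N); as Q is monotone with mean 0, the sum S of the
    y_i is nonnegative and bounded independently of N, so lowering the last
    point by S makes the sum exactly 0, and the points x_i = Phi y_i satisfy
    W2 (empirical x, m) ^ 2 = O (1 / N) by the coupling that is the law of
    (x_i, Phi (Q u)) for u uniform in the i-th cell.  The first J ~ lam N of
    the y_i are at least c and the others at most 0.

    For the mixed profile the back-transported points are the y_i, and removing
    y_i from a zero sum leaves - y_i, which has the right sign.  For a constant
    profile, strict monotonicity of the drift in sigma moves a positive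
    fraction of the back-transported points by a fixed amount delta, in the
    favourable direction; this beats the single omitted, bounded term once N is
    large. *)

(** * One-sided derivatives and differential inequalities *)

Section WithinDerivative.
Context {R : realType}.
Implicit Types (f : R -> R) (s t l : R).
Local Notation D := [set r : R | 0 <= r].

Lemma is_derive_within_interior f s l :
  0 < s -> is_derive_within D f s l -> is_derive s 1 f l.
Proof.
move=> s0 fl.
suff H : (fun h : R => h^-1 *: ((f \o shift s) (h *: (1 : R)) - f s)) @ 0^' --> l.
  apply: DeriveDef; first by apply/cvg_ex; exists l.
  exact/cvg_lim.
have sh : h + s @[h --> (0 : R)^'] --> within D s^'.
  move=> P /= [e /= e0 He]; exists (Num.min e s) => /=; first by rewrite lt_min e0.
  move=> h; rewrite /ball_ /= sub0r normrN lt_min => /andP[he hs] h0.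
  apply: He.
  - by rewrite /ball_ /= opprD addrCA subrr addr0 normrN.
  - by rewrite -subr_eq0 addrK.
  - have := lerNnormlW (ltW hs); rewrite /=; lra.
have := cvg_comp _ _ sh fl; apply: cvg_trans; apply: near_eq_cvg.
near=> h => /=.
by rewrite [h%:A]mulr1 addrK mulrC.
Unshelve. all: by end_near.
Qed.

Lemma is_derive_within_right f s l : 0 <= s -> is_derive_within D f s l ->
  (f r - f s) / (r - s) @[r --> s^'+] --> l.
Proof.
move=> s0; apply: cvg_trans; apply: cvg_app => P /= [e e0 He].
exists e => // r sre sr; apply: He => //; first by rewrite /= gt_eqF.
exact: le_trans s0 (ltW sr).
Qed.

Lemma is_derive_within_continuous f (df : R -> R) t : 0 < t ->
  (forall s, 0 <= s -> is_derive_within D f s (df s)) ->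
  {within `[0, t], continuous f}.
Proof.
move=> t0 fdf; apply/continuous_within_itvP => //.
have cf s : 0 < s -> {for s, continuous f}.
  move=> s0; apply/differentiable_continuous/derivable1_diffP.
  by have [] := is_derive_within_interior s0 (fdf _ (ltW s0)).
split.
- by move=> s; rewrite in_itv /= => /andP[s0 _]; exact: cf.
(* At 0 only the right quotient is available; [f r] is recovered as this quotient times [r], plus
   [f 0]. *)
- have fl := is_derive_within_right (lexx 0) (fdf _ (lexx 0)).
  have : (f r - f 0) / (r - 0) * r + f 0 @[r --> (0:R)^'+] --> df 0 * 0 + f 0.
    apply: cvgD; last exact: cvg_cst.
    apply: cvgM; first exact: fl.
    exact: cvg_at_right_filter.
  rewrite mulr0 add0r; apply: cvg_trans; apply: near_eq_cvg; near=> r.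
  have r0 : 0 < r by near: r; exact: nbhs_right_gt.
  by rewrite subr0 divfK ?gt_eqF// subrK.
- exact: cvg_at_left_filter (cf _ t0).
Unshelve. all: by end_near.
Qed.

Lemma is_derive_right f s l : is_derive s 1 f l ->
  (f r - f s) / (r - s) @[r --> s^'+] --> l.
Proof.
move=> [/cvg_ex [k fk] dl].
have {dl} -> : l = k by rewrite -dl; exact/cvg_lim.
have sh : r - s @[r --> s^'+] --> (0 : R)^'.
  move=> P /= [e /= e0 He]; exists e => //= r; rewrite /ball_ /= => rse sr.
  apply: He; rewrite /ball_ /=; first by rewrite sub0r opprB.
  by rewrite subr_eq0 gt_eqF.
have := cvg_comp _ _ sh fk; apply: cvg_trans; apply: near_eq_cvg.
near=> h => /=.
by rewrite [_%:A]mulr1 subrK mulrC.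
Unshelve. all: by end_near.
Qed.

End WithinDerivative.

Section DifferentialInequalities.
Context {R : realType}.
Implicit Types (w dw : R -> R) (a b L t : R).

Lemma continuous_expRZ L : continuous (fun s : R => expR (L * s)).
Proof.
move=> s; apply: (@continuous_comp _ _ _ (fun s => L * s) (@expR R)).
  exact: mulrl_continuous.
exact: continuous_expR.
Qed.

(* With the weight [expR (2 * k * s)], where [k = L] or [k = - L], the function
   [w ^ 2] becomes monotone. *)
Lemma gronwall w dw a b L : a <= b ->
  (forall s, a < s < b -> is_derive s 1 w (dw s)) ->
  {within `[a, b], continuous w} ->
  (forall s, a < s < b -> `|dw s| <= L * `|w s|) ->
  `|w b| <= expR (L * (b - a)) * `|w a| /\
  `|w a| <= expR (L * (b - a)) * `|w b|.
Proof.
move=> ab wdw cw dwL.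
pose u k s := expR (2 * k * s) * w s ^+ 2.
have du k s : a < s < b ->
    is_derive s 1 (u k) (expR (2 * k * s) * (2 * k * w s ^+ 2 + 2 * w s * dw s)).
  move=> /wdw dws; rewrite /u.
  apply: is_derive_eq.
  rewrite /GRing.scale /=. ring.
have cu k : {within `[a, b], continuous (u k)}.
  move=> s; apply: (@continuousM _ (subspace `[a, b]) (fun s => expR (2 * k * s))
    (fun s => w s ^+ 2)); last first.
    by apply: (@continuousM _ (subspace `[a, b]) w w); exact: cw.
  exact/continuous_subspaceT/continuous_expRZ.
have bnd s : a < s < b -> `|w s * dw s| <= L * w s ^+ 2.
  move=> sab; rewrite normrM -[w s ^+ 2]real_normK ?num_real// expr2 mulrA.
  by rewrite mulrC ler_wpM2r// dwL.
(* Taking square roots of [u k x <= u k y] halves the exponent 2k. The forward bound uses k = -L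
   with the endpoints exchanged, the backward one k = L. *)
have sqle k x y : u k x <= u k y -> `|w x| <= expR (k * (y - x)) * `|w y|.
  rewrite /u => H; rewrite -ler_sqr ?nnegrE ?mulr_ge0 ?expR_ge0//.
  rewrite exprMn !real_normK ?num_real// -expRM_natl.
  rewrite -(ler_pM2l (expR_gt0 (2 * k * x))); apply: le_trans H _.
  rewrite [leRHS]mulrA -expRD le_eqVlt; apply/orP; left; apply/eqP.
  congr (expR _ * _). ring.
have ain : a \in `[a, b] by rewrite in_itv /= lexx ab.
have bin : b \in `[a, b] by rewrite in_itv /= lexx ab.
have ddu k s : s \in `]a, b[ -> derivable (u k) s 1.
  by rewrite in_itv /= => /(du k) [].
split.
- have -> : L * (b - a) = - L * (a - b) by ring.
  apply: sqle; apply: (ler0_derive1_le_cc (ddu (- L)) _ (cu (- L)) bin ain ab).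
  move=> s; rewrite in_itv /= => sab.
  rewrite derive1E; have [_ ->] := du (- L) s sab.
  rewrite mulr_ge0_le0 ?expR_ge0//.
  have := le_trans (ler_norm _) (bnd s sab); lra.
- apply: sqle; apply: (ger0_derive1_le_cc (ddu L) _ (cu L) ain bin ab).
  move=> s; rewrite in_itv /= => sab.
  rewrite derive1E; have [_ ->] := du L s sab.
  rewrite mulr_ge0 ?expR_ge0//.
  have := lerNnormlW (bnd s sab); lra.
Qed.

(* Otherwise [expR (L * s) * w s] attains its minimum over [`[0, t]] at a point
   [s < t] with [w s <= 0] (a minimum at [t] is null, hence also attained at
   [0]), and the right derivative at such a point is negative. *)
Lemma backward_comparison w dw L t : 0 < t ->
  (forall s, 0 <= s -> is_derive_within [set r | 0 <= r] w s (dw s)) ->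
  (forall s, 0 <= s < t -> dw s < L * `|w s|) ->
  w t = 0 -> 0 < w 0.
Proof.
move=> t0 wdw dwL wt.
have cw := is_derive_within_continuous t0 wdw.
pose u s := expR (L * s) * w s.
have cu : {within `[0, t], continuous u}.
  move=> s; apply: (@continuousM _ (subspace `[0, t]) (fun s => expR (L * s)) w);
    last exact: cw.
  exact/continuous_subspaceT/continuous_expRZ.
rewrite ltNge; apply/negP => w0.
have [r0 r0t [wr0 minu]] : exists2 r0, 0 <= r0 < t & w r0 <= 0 /\
    forall s, 0 <= s <= t -> u r0 <= u s.
  have [c cin minc] := EVT_min (ltW t0) cu.
  move: cin; rewrite in_itv /= => /andP[c0 ct].
  have u0 : u c <= 0.
    apply: le_trans (minc t _) _; first by rewrite in_itv /= lexx ltW.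
    by rewrite /u wt mulr0.
  have [ct'|tc] := ltP c t; last first.
    have ctE : c = t by apply/eqP; rewrite eq_le ct.
    exists 0; first by rewrite lexx t0.
    split=> // s s0t; apply: (@le_trans _ _ (u c)); last by apply: minc; rewrite in_itv.
    by rewrite /u ctE mulr0 expR0 mul1r wt mulr0.
  exists c; first by rewrite c0.
  split; last by move=> s s0t; apply: minc; rewrite in_itv.
  by move: u0; rewrite /u pmulr_rle0// expR_gt0.
have r00 : 0 <= r0 by case/andP: r0t.
have wl := is_derive_within_right r00 (wdw _ r00).
have ul : (u r - u r0) / (r - r0) @[r --> r0^'+] -->
    expR (L * r0) * dw r0 + w r0 * (L * expR (L * r0)).
  have eq r : (u r - u r0) / (r - r0) =
      expR (L * r) * ((w r - w r0) / (r - r0)) +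
      w r0 * ((expR (L * r) - expR (L * r0)) / (r - r0)).
    by rewrite /u; ring.
  rewrite (eq_cvg _ _ eq).
  apply: cvgD.
    apply: cvgM => //; apply: cvg_at_right_filter.
    exact: continuous_expRZ.
  apply: cvgMl_tmp; apply: is_derive_right.
  apply: is_derive_eq. rewrite /GRing.scale /=. ring.
have : 0 <= expR (L * r0) * dw r0 + w r0 * (L * expR (L * r0)).
  apply: (cvgr_to_ge ul).
  near=> r.
  have rr : r0 < r by near: r; exact: nbhs_right_gt.
  have rt : r < t by near: r; apply: nbhs_right_lt; case/andP: r0t.
  rewrite divr_ge0 ?subr_ge0 ?minu ?(ltW rr)// (ltW rt) andbT.
  exact: le_trans r00 (ltW rr).
rewrite (_ : _ + _ = (dw r0 + L * w r0) * expR (L * r0)); last by ring.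
rewrite pmulr_lge0 ?expR_gt0// leNgt => /negP; apply.
(* Since [w r0 <= 0], the hypothesis on [dw] reads [dw r0 + L * w r0 < 0]. *)
have := dwL _ r0t; rewrite ler0_norm//; lra.
Unshelve. all: by end_near.
Qed.
End DifferentialInequalities.

(** * Flows of the drift *)

Lemma is_derive_withinB (R : realType) (D : set R) (f g : R -> R) (s l k : R) :
  is_derive_within D f s l -> is_derive_within D g s k ->
  is_derive_within D (fun r => f r - g r) s (l - k).
Proof.
move=> fl gk.
have eq r : (f r - g r - (f s - g s)) / (r - s) =
  (f r - f s) / (r - s) - (g r - g s) / (r - s) by ring.
by rewrite /is_derive_within (eq_cvg _ _ eq); exact: cvgB.
Qed.

Section Flow.
Context {R : realType} (lo hi : \bar R) (b : R -> R -> R -> R).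
Hypothesis hB : assumptionB lo hi b.

Lemma drift_lipschitz : exists L : R, 0 <= L /\ forall s sigma x y,
  0 <= s -> oitv lo hi sigma -> `|b s sigma x - b s sigma y| <= L * `|x - y|.
Proof.
(* The parameter interval may be empty here, in which case the bound [L] carries no sign; hence the
   absolute value. *)
have [L hL] := B_Dx_bounded hB; exists `|L|; split=> // s sigma x y s0 hs.
wlog xy : x y / y <= x => [H|].
  have [/H//|/ltW/H] := leP y x.
  by rewrite distrC [X in _ <= _ * X]distrC.
pose f := b s sigma.
have df z : derivable f z 1 by have [_ d _ _] := B_C1 hB z s0 hs; exact: d.
have [c _ ->] : exists2 c, c \in `[y, x] & f x - f y = derive1 f c * (x - y).
  apply: (MVT_segment xy) => [z _|].
    by rewrite derive1E; exact/derivableP/df.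
  by apply: derivable_within_continuous => z _; exact: df.
rewrite normrM ler_wpM2r//; apply: le_trans (ler_norm L).
exact: hL.
Qed.

Lemma drift_increasing : [set s : R | 0 <= s <= 1] `<=` oitv lo hi ->
  (forall t s x : R, 0 <= t -> oitv lo hi s -> 0 < Dsigma b t s x) ->
  forall s x, 0 <= s -> b s 0 x < b s 1 x.
Proof.
move=> h01 hinc s x s0; pose f := fun s' => b s s' x.
have in01 z : z \in `[0, 1] -> oitv lo hi z by rewrite in_itv /= => /h01.
have df z : z \in `[0, 1] -> derivable f z 1.
  by move=> /in01 hz; have [d _ _ _] := B_C1 hB x s0 hz; exact: d.
have oo z : z \in `]0, 1[ -> z \in `[0, 1 : R].
  by rewrite !in_itv /= => /andP[/ltW -> /ltW ->].
apply: (@gtr0_derive1_lt_cc _ f 0 1); rewrite ?in_itv /= ?lexx ?ler01 ?ltr01//.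
- by move=> z /oo /df.
- by move=> z /oo /in01; exact: hinc.
- exact: derivable_within_continuous.
Qed.

Variable X : R -> R -> R -> R -> R.
Hypothesis hX : is_flow lo hi b X.
Variable t : R.
Hypothesis ht : 0 < t.

Let solution sigma (f : R -> R) := forall s, 0 <= s ->
  is_derive_within [set r | 0 <= r] f s (b s sigma (f s)).

Let flow_solution u sigma x :
  0 <= u -> oitv lo hi sigma -> solution sigma (fun s => X s u sigma x).
Proof. by move=> u0 hs; have [] := hX x u0 hs. Qed.

Let flow_start u sigma x : 0 <= u -> oitv lo hi sigma -> X u u sigma x = x.
Proof. by move=> u0 hs; have [] := hX x u0 hs. Qed.

(** The difference w of two solutions with the same parameter satisfies |w'| <= L |w|, so Gronwall's
    inequality applies in both time directions. Uniqueness and the Lipschitz bounds for the flow and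
    its inverse all come from this estimate. *)
Let solution_gronwall : exists E : R, 0 <= E /\ forall sigma f g,
  oitv lo hi sigma -> solution sigma f -> solution sigma g ->
  `|f t - g t| <= E * `|f 0 - g 0| /\ `|f 0 - g 0| <= E * `|f t - g t|.
Proof.
have [L [L0 lip]] := drift_lipschitz.
exists (expR (L * (t - 0))); split=> [|sigma f g hs hf hg]; first exact: expR_ge0.
have hw s (s0 : 0 <= s) := is_derive_withinB (hf s s0) (hg s s0).
apply: (@gronwall _ (fun s => f s - g s)
  (fun s => b s sigma (f s) - b s sigma (g s)) 0 t L (ltW ht)).
- by move=> s /andP[s0 _]; exact: is_derive_within_interior s0 (hw s (ltW s0)).
- exact: is_derive_within_continuous ht hw.
- by move=> s /andP[/ltW s0 _]; exact: lip.
Qed.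

(** The two solutions involved agree at time t, hence at time 0 by the backward estimate. *)
Lemma flow_inverse sigma x : oitv lo hi sigma ->
  X 0 t sigma (X t 0 sigma x) = x.
Proof.
move=> hs; have [E [_ H]] := solution_gronwall.
have [_] := H _ _ _ hs (@flow_solution t _ (X t 0 sigma x) (ltW ht) hs)
  (@flow_solution 0 _ x (lexx 0) hs).
rewrite (flow_start _ (ltW ht) hs) (flow_start _ (lexx 0) hs) subrr normr0 mulr0.
by rewrite normr_le0 subr_eq0 => /eqP.
Qed.

Lemma flow_lipschitz : exists E : R, 0 <= E /\ forall sigma x y,
  oitv lo hi sigma ->
  `|X t 0 sigma x - X t 0 sigma y| <= E * `|x - y| /\
  `|X 0 t sigma x - X 0 t sigma y| <= E * `|x - y|.
Proof.
have [E [E0 H]] := solution_gronwall; exists E; split=> // sigma x y hs; split.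
  have [] := H _ _ _ hs (@flow_solution 0 _ x (lexx 0) hs)
    (@flow_solution 0 _ y (lexx 0) hs).
  by rewrite !flow_start.
have [_] := H _ _ _ hs (@flow_solution t _ x (ltW ht) hs)
  (@flow_solution t _ y (ltW ht) hs).
by rewrite !(flow_start _ (ltW ht) hs).
Qed.

Lemma flow_displacement : exists M : R, forall sigma x, oitv lo hi sigma ->
  `|X t 0 sigma x - x| <= M /\ `|X 0 t sigma x - x| <= M.
Proof.
have [M hM] := B_bounded hB; exists (M * t) => sigma x hs.
have disp f : solution sigma f -> `|f t - f 0| <= M * t.
  move=> hf; have [|c cin ->] := MVT (df := fun s => b s sigma (f s)) ht _
      (is_derive_within_continuous ht hf).
    move=> s; rewrite in_itv /= => /andP[s0 _].
    exact: is_derive_within_interior s0 (hf s (ltW s0)).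
  rewrite subr0 normrM (gtr0_norm ht) ler_wpM2r ?(ltW ht)// hM//.
  by move: cin; rewrite in_itv /= => /andP[/ltW].
split; first by have := disp _ (@flow_solution 0 _ x (lexx 0) hs); rewrite flow_start.
have := disp _ (@flow_solution t _ x (ltW ht) hs).
by rewrite (flow_start _ (ltW ht) hs) distrC.
Qed.

Hypothesis h01 : [set s : R | 0 <= s <= 1] `<=` oitv lo hi.
Hypothesis hinc :
  forall t s x : R, 0 <= t -> oitv lo hi s -> 0 < Dsigma b t s x.

Let i0 : oitv lo hi 0. Proof. by apply: h01 => /=; rewrite lexx ler01. Qed.
Let i1 : oitv lo hi 1. Proof. by apply: h01 => /=; rewrite lexx ler01. Qed.

(** At parameter 0, replacing g by f changes the drift by at most L |f - g|, and at g the drift with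
    parameter 0 is strictly below the one with parameter 1. So f - g has derivative strictly below L
    |f - g|, and it vanishes at t. *)
Let solution_comparison f g : solution 0 f -> solution 1 g -> f t = g t -> g 0 < f 0.
Proof.
move=> hf hg fg; have [L [L0 lip]] := drift_lipschitz.
have hw s (s0 : 0 <= s) := is_derive_withinB (hf s s0) (hg s s0).
rewrite -subr_gt0.
apply: (@backward_comparison _ (fun s => f s - g s) _ L t ht hw).
  move=> s /andP[s0 _].
  have := drift_increasing h01 hinc (g s) s0.
  have := le_trans (ler_norm _) (lip s 0 (f s) (g s) s0 i0); lra.
by rewrite fg subrr.
Qed.

(** Going forward with the larger drift and back with the smaller one ends to the right of the
    start. This strict displacement, and its mirror image below, drive the constant equilibria. *)
Lemma flow_back0_gt x : x < X 0 t 0 (X t 0 1 x).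
Proof.
have := solution_comparison (@flow_solution t _ (X t 0 1 x) (ltW ht) i0)
  (@flow_solution 0 _ x (lexx 0) i1).
by rewrite (flow_start _ (ltW ht) i0) (flow_start _ (lexx 0) i1); exact.
Qed.

Lemma flow_back1_lt x : X 0 t 1 (X t 0 0 x) < x.
Proof.
have := solution_comparison (@flow_solution 0 _ x (lexx 0) i0)
  (@flow_solution t _ (X t 0 0 x) (ltW ht) i1).
by rewrite (flow_start _ (ltW ht) i1) (flow_start _ (lexx 0) i0); exact.
Qed.

End Flow.

(** * Probability measures on the line and quantile functions *)

Section RealProbability.
Context {R : realType}.
Local Notation T := (measurableTypeR R).
Implicit Types (P : probability T R) (x y : R).

(** Every point outside the support lies in a null open interval with rational endpoints, and there
    are countably many of these; [F] enumerates them. *)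
Lemma msupport_negligible (P : probability T R) : P.-negligible (~` msupport P).
Proof.
pose J (p : rat * rat) : set T := `](ratr p.1), (ratr p.2)[%classic.
have [enum enumP] : exists enum : nat -> option (rat * rat),
    forall p, exists n, enum n = Some p.
  by exists unpickle => p; exists (pickle p); exact: pickleK.
pose F n : set T := if enum n is Some p then
  (if P (J p) == 0%E then J p else set0) else set0.
have : P.-negligible (\bigcup_n F n).
  apply: negligible_bigcup => n; rewrite /F.
  case: (enum n) => [p|]; last exact: negligible_set0.
  case: ifPn => [/eqP P0|_]; last exact: negligible_set0.
  by exists (J p); split => //; exact: measurable_itv.
apply: negligibleS => x /existsNP[U] /not_implyP[oU] /not_implyP[Ux PU].
have /nbhs_ballP[e /= e0 xeU] : nbhs x U by exact: open_nbhs_nbhs.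
have [q1] : exists q : rat, ratr q \in `](x - e), x[.
  by apply: rat_in_itvoo; rewrite ltrBlDr ltrDl.
rewrite in_itv /= => /andP[eq1 q1x].
have [q2] : exists q : rat, ratr q \in `]x, (x + e)[.
  by apply: rat_in_itvoo; rewrite ltrDl.
rewrite in_itv /= => /andP[xq2 q2e].
have [n nE] := enumP (q1, q2).
exists n; first exact: I; rewrite /F nE.
have IU : J (q1, q2) `<=` U.
  move=> y; rewrite /J /= in_itv /= => /andP[q1y yq2]; apply: xeU.
  rewrite /ball /= ltr_distl; apply/andP; split; lra.
rewrite ifT; first by rewrite /J /= in_itv /= q1x xq2.
rewrite eq_le measure_ge0 andbT; move/negP: PU; rewrite -leNgt.
apply: le_trans; apply: le_measure; rewrite ?inE//.
- exact: measurable_itv.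
- exact: open_measurable.
Qed.

Lemma probability_setI_full d (S : measurableType d) (Q : probability S R) A D :
  measurable A -> measurable D -> Q D = 1%E -> Q (A `&` D) = Q A.
Proof.
move=> mA mD QD.
have mAC : measurable (A `&` ~` D) by apply: measurableI => //; exact: measurableC.
have mAD : measurable (A `&` D) by exact: measurableI.
have null : Q (A `&` ~` D) = 0%E.
  apply/eqP; rewrite eq_le measure_ge0 andbT.
  have <- : Q (~` D) = 0%E by rewrite probability_setC// QD subee.
  by apply: le_measure; rewrite ?inE//; exact: measurableC.
rewrite -[in RHS](setIT A) -(setvU D) setIUr measureU//.
  by rewrite -[LHS]add0e; congr (_ + _)%E; exact/esym/null.
by rewrite setIACA setICl setI0.
Qed.

(** This is right continuity of the distribution function, from continuity from above along q + 1 /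
    (n + 1). *)
Lemma cdf_ge_right P (u q : R) :
  (forall x, q < x -> (u%:E <= P `]-oo, x]%classic)%E) ->
  (u%:E <= P `]-oo, q]%classic)%E.
Proof.
move=> H.
pose F n : set T := [set` Interval -oo%O (BSide false (q + n.+1%:R^-1))].
have : (P \o F) n @[n --> \oo] --> P (\bigcap_n F n).
  apply: nonincreasing_cvg_mu => [|n||m n mn].
  - by rewrite (le_lt_trans (probability_le1 _ _)) ?ltry//; exact: measurable_itv.
  - exact: measurable_itv.
  - by apply: bigcap_measurable => // n _; exact: measurable_itv.
  - apply/subsetPset; apply: subset_itvl.
    by rewrite bnd_simp lerD2l lef_pV2 ?posrE// ler_nat.
rewrite -itvNycEbigcap => /cvge_to_ge; apply; near=> n.
by apply: H; rewrite ltrDl.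
Unshelve. all: by end_near.
Qed.

(** The rays []x, +oo[] are stable under intersection and generate the Borel sets; their masses are
    the complements of the distribution function. *)
Lemma probability_unique P P' :
  (forall x : R, P `]-oo, x]%classic = P' `]-oo, x]%classic) ->
  forall A, measurable A -> P A = P' A.
Proof.
move=> PP' A mA.
move: A mA; apply: (@measure_unique _ R T (@RGenOInfty.G R)
  (fun n => `](- n%:R), +oo[%classic)).
- exact: RGenOInfty.measurableE.
- move=> _ _ [x ->] [y ->]; exists (Num.max x y).
  by apply/seteqP; split => z /=; rewrite !in_itv /= !andbT gt_max => /andP.
- by move=> n; exists (- n%:R).
- apply/seteqP; split => // x _.
  exists (Num.truncn `|x|).+1 => //=; rewrite in_itv /= andbT ltrNl.
  by rewrite (le_lt_trans _ (truncnS_gt _))// -normrN ler_norm.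
- move=> _ [x ->].
  have ccdf (Q : probability T R) :
      Q `]x, +oo[%classic = (1 - Q `]-oo, x]%classic)%E.
    by rewrite -probability_setC ?setCitvl//; exact: measurable_itv.
  by apply: etrans (ccdf P) _; rewrite PP' -ccdf.
- by move=> k; rewrite (le_lt_trans (probability_le1 _ _)) ?ltry.
Qed.
Lemma uniform_itvoc (x y : R) : 0 <= x -> x <= y -> y <= 1 ->
  uniform_prob (@ltr01 R) `]x, y]%classic = (y - x)%:E.
Proof.
move=> x0 xy y1; rewrite /uniform_prob.
rewrite (eq_integral (fun=> 1%E)) => [|z]; last first.
  rewrite inE /= in_itv /= => /andP[xz zy]; rewrite /uniform_pdf subr0 invr1 ifT//.
  by rewrite (le_trans x0 (ltW xz)) (le_trans zy y1).
rewrite integral_cst ?measurable_itv//= mul1e lebesgue_measure_itv/= lte_fin.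
case: ltP => [//|yx]. by rewrite (_ : y = x) ?subrr//; apply/eqP; rewrite eq_le xy yx.
Qed.

End RealProbability.

Section Quantile.
Context {R : realType}.
Local Notation T := (measurableTypeR R).
Local Notation U := (uniform_prob (@ltr01 R)).
Variables (P : probability T R) (a b : R).
Hypothesis Pab : P `[a, b]%classic = 1%E.

(* The truncations by [a] and [1] make this total, nondecreasing and bounded:
   for [u] in ]0, 1] it is the usual quantile function. *)
Definition quantile (u : R) : R :=
  inf [set x | a <= x /\ ((Num.min u 1)%:E <= P `]-oo, x]%classic)%E].

Let ab : a <= b.
Proof.
rewrite leNgt; apply/negP => ba; have := Pab.
by rewrite set_itv_ge ?bnd_simp -?ltNge// measure0 => /esym/eqP; rewrite onee_eq0.
Qed.

Let cdf_mono x y : x <= y -> (P `]-oo, x]%classic <= P `]-oo, y]%classic)%E.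
Proof.
move=> xy; apply: le_measure; rewrite ?inE; [exact: measurable_itv..|].
by apply: subset_itvl; rewrite bnd_simp.
Qed.

Let cdf_ge x : b <= x -> P `]-oo, x]%classic = 1%E.
Proof.
move=> bx; apply/eqP; rewrite eq_le probability_le1 ?measurable_itv//= -Pab.
apply: le_measure; rewrite ?inE; [exact: measurable_itv..|].
by move=> y /=; rewrite !in_itv /= => /andP[_ yb]; exact: le_trans yb bx.
Qed.

Let cdf_lt x : x < a -> P `]-oo, x]%classic = 0%E.
Proof.
move=> xa; apply/eqP; rewrite eq_le measure_ge0 andbT.
have <- : P (~` `[a, b]%classic) = 0%E.
  by rewrite probability_setC ?measurable_itv// [X in (1 - X)%E]Pab subee.
apply: le_measure; rewrite ?inE; [exact: measurable_itv| |].
  by apply: measurableC; exact: measurable_itv.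
move=> y /=; rewrite !in_itv /= => yx /andP[ay _].
by have := le_lt_trans yx xa; rewrite ltNge ay.
Qed.

Let S (u : R) := [set x | a <= x /\ ((Num.min u 1)%:E <= P `]-oo, x]%classic)%E].

Let S_lb u : lbound (S u) a. Proof. by move=> x []. Qed.

Let S_b u : S u b.
Proof. by split=> //; rewrite cdf_ge// lee_fin ge_min lexx orbT. Qed.

Let S_inf u : has_inf (S u).
Proof. by split; [exists b; exact: S_b|exists a; exact: S_lb]. Qed.

Lemma quantile_itv u : a <= quantile u <= b.
Proof.
apply/andP; split; first by apply: lb_le_inf; [exists b; exact: S_b|exact: S_lb].
by apply: ge_inf; [exists a; exact: S_lb|exact: S_b].
Qed.

Lemma quantile_nondecreasing : {homo quantile : u v / u <= v}.
Proof.
move=> u v uv; apply: lb_le_inf; first by exists b; exact: S_b.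
move=> x [ax vx]; apply: ge_inf; first by exists a; exact: S_lb.
split=> //; apply: le_trans vx; rewrite lee_fin.
by rewrite le_min !ge_min uv lexx orbT.
Qed.

(** Right continuity makes the infimum attained, so the quantile and the distribution function form
    a Galois connection. *)
Lemma quantile_le u x : 0 < u <= 1 ->
  (quantile u <= x) = (u%:E <= P `]-oo, x]%classic)%E.
Proof.
move=> /andP[u0 u1]; apply/idP/idP => [qx|ux].
  apply: (@le_trans _ _ (P `]-oo, quantile u]%classic)); last exact: cdf_mono.
  apply: cdf_ge_right => y qy.
  have [z [az Sz] zy] := inf_lt (proj1 (S_inf u)) qy.
  by apply: le_trans (cdf_mono (ltW zy)); move: Sz; rewrite min_l.
apply: ge_inf; first by exists a; exact: S_lb.
split; last by rewrite min_l.
(* The constraint [a <= x] is automatic: the distribution function vanishes to the left of [a],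
   while [u] is positive. *)
rewrite leNgt; apply/negP => /cdf_lt xa; move: ux; rewrite xa lee_fin.
by rewrite leNgt u0.
Qed.

Lemma measurable_quantile : measurable_fun [set: T] (quantile : T -> T).
Proof. by apply: nondecreasing_measurable => //; exact: quantile_nondecreasing. Qed.

Lemma quantile_le0 u : u <= 0 -> quantile u = a.
Proof.
move=> u0; apply/eqP; rewrite eq_le; apply/andP; split;
  last by have /andP[] := quantile_itv u.
apply: ge_inf; first by exists a; exact: S_lb.
split=> //; apply: (@le_trans _ _ 0%E); last exact: measure_ge0.
by rewrite lee_fin ge_min u0.
Qed.

(** Inverse transform sampling: inside ]0, 1], which has full mass, the Galois connection turns the
    preimage of []-oo, x]] into an interval ]0, F x], whose length is the value F x of the
    distribution function. *)
Lemma quantile_pushforward (A : set T) : measurable A ->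
  U (quantile @^-1` A) = P A.
Proof.
pose qm : {mfun T >-> T} := @mfun_Sub _ _ T T quantile (mem_set measurable_quantile).
pose D : probability T R := distribution U qm.
apply: (@probability_unique _ D P) => x.
have mx : measurable (`]-oo, x]%classic : set T) by exact: measurable_itv.
have finP : P `]-oo, x]%classic \is a fin_num by exact: (fin_num_measure P _ mx).
have Fx0 : 0 <= fine (P `]-oo, x]%classic) by exact: fine_ge0.
have Fx1 : fine (P `]-oo, x]%classic) <= 1.
  by rewrite -lee_fin fineK//; exact: (probability_le1 P mx).
have mpre : measurable (quantile @^-1` `]-oo, x]%classic : set T).
  exact: (measurable_funPTI qm (measurable_itv _)).
rewrite /D /distribution /pushforward /=.
have U01 : U `]0%R, 1%R]%classic = 1%E
  by apply: etrans (uniform_itvoc (lexx 0) ler01 (lexx 1)) _; rewrite subr0.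
rewrite -(probability_setI_full mpre (measurable_itv _) U01).
rewrite (_ : _ `&` _ = `]0, (fine (P `]-oo, x]%classic))]%classic).
  by apply: etrans (uniform_itvoc (lexx 0) Fx0 Fx1) _; rewrite subr0 fineK.
apply/seteqP; split => u /=; rewrite !in_itv /=.
  move=> [qu u01]; move: qu; rewrite quantile_le// => uP.
  by case/andP: u01 => -> _; rewrite -lee_fin fineK.
move=> /andP[u0 uF]; have u01 : 0 < u <= 1 by rewrite u0 (le_trans uF).
by split => //; rewrite quantile_le// -(fineK finP) lee_fin.
Qed.

End Quantile.

(** * Empirical measures, mixtures and the Wasserstein distance *)

Section Empirical.
Context {R : realType}.
Local Notation T := (measurableTypeR R).
Implicit Types s : seq R.

Lemma empiricalE s (A : set T) :
  empirical s A = ((size s)%:R^-1 * \sum_(y <- s) \1_A y)%:E.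
Proof.
rewrite /empirical /mscale /= /msum EFinM; congr (_ * _)%E.
rewrite -sumEFin (big_nth 0) big_mkord.
by apply: eq_bigr.
Qed.

Lemma ge0_integral_empirical s (f : R -> R) : measurable_fun [set: T] f ->
  (forall y, 0 <= f y) ->
  (\int[empirical s]_y (f y)%:E = ((size s)%:R^-1 * \sum_(y <- s) f y)%:E)%E.
Proof.
move=> mf f0; have mEf : measurable_fun [set: T] (EFin \o f) by exact/measurable_EFinP.
rewrite /empirical ge0_integral_mscale//; last by move=> y _; rewrite lee_fin.
rewrite ge0_integral_measure_sum//; last by move=> y _; rewrite lee_fin.
rewrite EFinM; congr (_ * _)%E.
rewrite -sumEFin (big_nth 0) big_mkord; apply: eq_bigr => i _.
by rewrite integral_dirac// diracT mul1e.
Qed.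

(** The identity has no sign, so its positive and negative parts are integrated separately and
    recombined. *)
Lemma sigma0_empirical s :
  sigma0 (empirical s) = threshold ((size s)%:R^-1 * \sum_(y <- s) y).
Proof.
rewrite /sigma0; congr threshold.
have pos : (\int[empirical s]_y (Num.max y 0)%:E =
    ((size s)%:R^-1 * \sum_(y <- s) Num.max y 0)%:E)%E.
  apply: ge0_integral_empirical; last by move=> y; rewrite le_max lexx orbT.
  exact: measurable_maxr.
have neg : (\int[empirical s]_y (Num.max (- y) 0)%:E =
    ((size s)%:R^-1 * \sum_(y <- s) Num.max (- y) 0)%:E)%E.
  apply: ge0_integral_empirical; last by move=> y; rewrite le_max lexx orbT.
  by apply: measurable_maxr => //; exact: measurable_funN.
rewrite /Rintegral integralE.
rewrite (_ : (fun x : R => x%:E)^\+ = fun y => (Num.max y 0)%:E)%E; last first.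
  by apply/funext => y; rewrite funeposE EFin_max.
rewrite (_ : (fun x : R => x%:E)^\- = fun y => (Num.max (- y) 0)%:E)%E; last first.
  by apply/funext => y; rewrite funenegE EFin_max.
rewrite [X in (X - _)%E]pos [X in (_ - X)%E]neg /= -mulrBr -sumrB; congr (_ * _).
apply: eq_bigr => y _; have [y0|/ltW y0] := leP 0 y.
  by rewrite max_r ?oppr_le0// subr0.
by rewrite max_l ?oppr_ge0// sub0r opprK.
Qed.

Lemma mix_probability (l : R) (P P' : probability T R) : 0 <= l <= 1 ->
  exists M : probability T R, (M : set T -> \bar R) = mix l P P'.
Proof.
move=> /andP[l0 l1]; have l1' : 0 <= 1 - l by rewrite subr_ge0.
pose mu : {measure set T -> \bar R} := mscale (NngNum l1') P.
pose nu : {measure set T -> \bar R} := mscale (NngNum l0) P'.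
(* A sum of length 2 sees only the indices 0 and 1, so the default branch contributes [nu] once. *)
pose m := msum (fun n => if n is 0%N then mu else nu) 2.
have mE : m = mix l P P'.
  by apply/funext => A; rewrite /m /msum 2!big_ord_recl big_ord0 adde0.
have m1 : m setT = 1%E.
  by rewrite mE /mix !probability_setT !mule1 -EFinD subrK.
pose M : probability T R := HB.pack m (Measure_isProbability.Build _ _ _ m m1).
by exists M.
Qed.

End Empirical.

(** * Couplings through a partition into cells of equal mass *)

Section StepCoupling.
Context {R : realType} d (S : measurableType d) (U : probability S R).
Context (N : nat) (idx : S -> 'I_N).
Hypothesis midx : forall i, measurable (idx @^-1` [set i]).
Hypothesis Uidx : forall i, U (idx @^-1` [set i]) = (N%:R^-1)%:E.
Local Notation T := (measurableTypeR R).
Implicit Types h x g : 'I_N -> R.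

Lemma measurable_step h : measurable_fun [set: S] (h \o idx : S -> T).
Proof.
move=> _ A mA; rewrite setTI.
rewrite (_ : _ @^-1` _ = \bigcup_(i in [set i | A (h i)]) (idx @^-1` [set i])).
  by apply: fin_bigcup_measurable; [exact: finite_finset|move=> i _; exact: midx].
apply/seteqP; split => w /=; [by exists (idx w)|case=> i /= Ai].
by rewrite -[_ = i]/(idx w = i) => iE; rewrite -iE in Ai.
Qed.

Let stepE h w : h (idx w) = \sum_i h i * \1_(idx @^-1` [set i]) w.
Proof.
rewrite (bigD1 (idx w))//= big1 ?addr0 => [|i iw].
  by rewrite indicE mem_set ?mulr1.
by rewrite indicE memNset ?mulr0//= => /esym/eqP; rewrite (negbTE iw).
Qed.

Let integrable_indic i : U.-integrable setT (fun w => (\1_(idx @^-1` [set i]) w)%:E).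
Proof. exact: integrable_indic. Qed.

Let integrable_term (a : R) i :
  U.-integrable setT (fun w => (a * \1_(idx @^-1` [set i]) w)%:E).
Proof. by under eq_fun do rewrite EFinM; exact: integrableZl. Qed.

Lemma integrable_step h : U.-integrable setT (fun w => (h (idx w))%:E).
Proof.
under eq_fun do rewrite stepE -sumEFin.
by apply: integrable_sum => // i _; exact: integrable_term.
Qed.

Lemma integral_step h :
  (\int[U]_w (h (idx w))%:E = (N%:R^-1 * \sum_i h i)%:E)%E.
Proof.
under eq_integral do rewrite stepE -sumEFin.
rewrite integral_sum//.
rewrite mulr_sumr -sumEFin; apply: eq_bigr => i _.
under eq_integral do rewrite EFinM.
have Ui : (\int[U]_w (\1_(idx @^-1` [set i]) w)%:E = (N%:R^-1)%:E)%E.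
  by rewrite integral_indic// setIT; exact: Uidx.
by rewrite integralZl// Ui -EFinM mulrC.
Qed.

(** The joint law of [x (idx w)] and [Z w] is a coupling, because the cells have equal mass; its
    cost is at most the average of the squares of [g]. *)
Lemma W2_empirical_le (m : set T -> \bar R) (Z : S -> T) x g :
  measurable_fun [set: S] Z ->
  (forall A : set T, measurable A -> m A = U (Z @^-1` A)) ->
  (forall w, `|x (idx w) - Z w| <= g (idx w)) ->
  (W2 (empirical [seq x i | i <- enum 'I_N]) m <=
    (Num.sqrt (N%:R^-1 * \sum_i g i ^+ 2))%:E)%E.
Proof.
move=> mZ mE xZ.
have mW := measurable_step x.
pose V : {mfun S >-> (T * T)%type} :=
  @mfun_Sub _ _ S (T * T)%type (fun w => (x (idx w), Z w))
    (mem_set (measurable_fun_pair mW mZ)).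
pose pi : probability (T * T)%type R := distribution U V.
have coupling : is_coupling (empirical [seq x i | i <- enum 'I_N]) m pi.
  move=> A mA; split; last first.
    rewrite mE// /pi /distribution /pushforward; congr (U _).
    by apply/seteqP; split => w /= => [[]|].
  rewrite empiricalE size_map size_enum_ord big_map big_enum /=.
  rewrite -(integral_step (fun i => \1_A (x i))).
  transitivity (\int[U]_w (\1_((x \o idx) @^-1` A) w)%:E)%E.
    have mWA := mW measurableT A mA; rewrite setTI in mWA.
    rewrite integral_indic ?setIT//.
    rewrite /pi /distribution /pushforward; congr (U _).
    by apply/seteqP; split => w /= => [[]|].
  by apply: eq_integral => w _; rewrite !indicE.
have mcost : measurable_fun [set: (T * T)%type]
    (fun z : T * T => (`|z.1 - z.2| ^+ 2)%:E).
  apply/measurable_EFinP; apply: measurable_funX; apply: measurableT_comp => //.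
  by apply: measurable_funB.
have cost : (\int[pi]_z (`|z.1 - z.2| ^+ 2)%:E <= (N%:R^-1 * \sum_i g i ^+ 2)%:E)%E.
  rewrite ge0_integral_distribution//.
  rewrite -(integral_step (fun i => g i ^+ 2)); apply: ge0_le_integral => //.
  - by move=> w _; rewrite lee_fin sqr_ge0.
  - exact: measurableT_comp.
  - by apply/measurable_EFinP; exact: (measurable_step (fun i => g i ^+ 2)).
  - move=> w _; rewrite lee_fin /= lerXn2r ?nnegrE//.
    exact: le_trans (xZ w).
rewrite /W2 poweR12_sqrt; last first.
  apply: le_ereal_inf_tmp => _ [p _ <-].
  by apply: integral_ge0 => z _; rewrite lee_fin sqr_ge0.
rewrite -[leRHS]/(sqrte (N%:R^-1 * \sum_i g i ^+ 2)%:E) lee_sqrt; last first.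
  by rewrite lee_fin mulr_ge0// sumr_ge0// => i _; rewrite sqr_ge0.
by apply: le_trans cost; apply: ereal_inf_lbound; exists pi.
Qed.

End StepCoupling.

(** * Balanced quantization of a measure with a gap *)

Section UnitCell.
Context {R : realType} (n : nat).
Local Notation T := (measurableTypeR R).
Local Notation N := (n.+1%:R : R).

(* The cell of index [i] is ]1 - (i + 1) / N, 1 - i / N], the two extreme ones
   being extended to infinity. *)
Definition unit_cell (u : R) : 'I_n.+1 := inord (minn (Num.truncn (N * (1 - u))) n).

Let N_gt0 : 0 < N. Proof. by rewrite ltr0n. Qed.

Let unit_cellE u : unit_cell u = minn (Num.truncn (N * (1 - u))) n :> nat.
Proof. by rewrite inordK// ltnS geq_minr. Qed.

(** Clamping [u] to [0, 1] absorbs the two unbounded cells, so the later error bounds hold for every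
    real [u] and not only almost everywhere. *)
Lemma unit_cell_bounds u : let i := unit_cell u in
  1 - i.+1%:R / N <= Num.min (Num.max u 0) 1 <= 1 - i%:R / N.
Proof.
move=> /=; rewrite unit_cellE.
have [u1|u1] := leP 1 u.
  rewrite (_ : Num.truncn _ = 0%N) ?min0n; last first.
    apply/eqP; rewrite -leqn0 truncn_le_nat; apply: le_lt_trans ltr01.
    by rewrite pmulr_rle0// subr_le0.
  rewrite mul0r subr0 min_r ?lexx ?andbT; last by rewrite le_max u1.
  by rewrite gerBl divr_ge0.
rewrite min_l; last by rewrite ge_max (ltW u1) ler01.
have [u0|u0] := leP u 0.
  have N1u : N <= N * (1 - u) by rewrite ler_peMr ?(ltW N_gt0)//; lra.
  rewrite (minn_idPr _); last first.
    rewrite truncn_ge_nat; last exact: le_trans (ltW N_gt0) N1u.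
    by apply: le_trans N1u; rewrite ler_nat.
  rewrite divff ?gt_eqF// subrr subr_ge0 ler_pdivrMr// mul1r ler_nat leqnSn andbT.
  exact: lexx.
have N1u : 0 <= N * (1 - u) by rewrite mulr_ge0// subr_ge0 ltW.
have /andP[le_t lt_t] := truncn_itv N1u.
rewrite (minn_idPl _); last first.
  by rewrite truncn_le_nat gtr_pMr// gtrBl.
rewrite lerBlDr -lerBlDl ler_pdivlMr// lerBrDl -lerBrDr ler_pdivrMr//.
by rewrite ![_ * N]mulrC le_t andbT ltW.
Qed.

(** Read as a real number, the cell index is a nonincreasing function of [u], hence measurable. *)
Lemma measurable_unit_cell i : measurable (unit_cell @^-1` [set i] : set T).
Proof.
pose f (u : T) : T := (minn (Num.truncn (N * (1 - u))) n)%:R.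
have mf : measurable_fun [set: T] f.
  apply: nonincreasing_measurable => // u v uv.
  rewrite ler_nat leq_min geq_minr andbT geq_min; apply/orP; left.
  by apply: le_truncn; rewrite ler_wpM2l// lerB.
have := mf measurableT _ (measurable_set1 (i%:R : T)); rewrite setTI.
congr measurable; apply/seteqP; split => u /=.
  by move=> /eqP; rewrite eqr_nat => /eqP fi; apply: val_inj; rewrite /= unit_cellE.
by move=> <-; rewrite unit_cellE.
Qed.

(** The uniform law is carried by ]0, 1], where every cell, the extreme ones included, is a
    half-open interval of length 1 / N. *)
Lemma uniform_unit_cell i :
  uniform_prob (@ltr01 R) (unit_cell @^-1` [set i]) = (N^-1)%:E.
Proof.
have U01 : uniform_prob (@ltr01 R) `]0%R, 1%R]%classic = 1%E.
  by apply: etrans (uniform_itvoc (lexx 0) ler01 (lexx 1)) _; rewrite subr0.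
rewrite -(probability_setI_full (measurable_unit_cell i) (measurable_itv _) U01).
have iN : i.+1%:R <= N by rewrite ler_nat.
have e : 1 - i%:R / N - (1 - i.+1%:R / N) = N^-1 by rewrite -[i.+1%:R]natr1; ring.
have lo : 0 <= 1 - i.+1%:R / N by rewrite subr_ge0 ler_pdivrMr// mul1r.
have hi : 1 - i%:R / N <= 1 by rewrite gerBl divr_ge0.
have lohi : 1 - i.+1%:R / N <= 1 - i%:R / N by rewrite -subr_ge0 e invr_ge0 ltW.
rewrite (_ : _ `&` _ = `](1 - i.+1%:R / N), (1 - i%:R / N)]%classic); last first.
  have inE u : 0 < u <= 1 -> (unit_cell u = i) <-> (i%:R <= N * (1 - u) < i.+1%:R).
    move=> /andP[u0 u1].
    have N1u : 0 <= N * (1 - u) by rewrite mulr_ge0// subr_ge0.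
    have tn : (Num.truncn (N * (1 - u)) <= n)%N.
      by rewrite truncn_le_nat gtr_pMr// gtrBl.
    rewrite -truncn_eq// -[X in X == _](minn_idPl tn) -unit_cellE.
    by split=> [->//|/eqP/val_inj].
  have cellE u : (1 - i.+1%:R / N < u <= 1 - i%:R / N) =
      (i%:R <= N * (1 - u) < i.+1%:R).
    rewrite andbC; congr andb.
      by rewrite lerBrDl -lerBrDr ler_pdivrMr// mulrC.
    by rewrite ltrBlDr -ltrBlDl ltr_pdivlMr// mulrC.
  apply/seteqP; split => u /=; rewrite !in_itv /= cellE.
    by move=> [ui u01]; apply/inE.
  move=> ui; have u01 : 0 < u <= 1.
    move: ui; rewrite -cellE => /andP[u1 u2].
    by rewrite (le_lt_trans lo u1) (le_trans u2 hi).
  by split => //; apply/inE.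
by apply: etrans (uniform_itvoc lo lohi hi) _; rewrite e.
Qed.

End UnitCell.

Section Full.
Context {R : realType}.
Local Notation T := (measurableTypeR R).
Implicit Types (P : probability T R) (D B : set T).

Lemma probability_full_sub P D B : measurable D -> measurable B ->
  P D = 1%E -> D `<=` B -> P B = 1%E.
Proof.
move=> mD mB PD DB; apply/eqP; rewrite eq_le probability_le1//= -PD.
by apply: le_measure; rewrite ?inE.
Qed.

Lemma probability_full_disjoint P D B : measurable D -> measurable B ->
  P D = 1%E -> D `<=` ~` B -> P B = 0%E.
Proof.
move=> mD mB PD DB.
apply/eqP; rewrite eq_le measure_ge0 andbT.
have <- : P (~` D) = 0%E by rewrite probability_setC// PD subee.
apply: le_measure; rewrite ?inE//; first exact: measurableC.
by rewrite -[B]setCK; exact: subsetC.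
Qed.

Lemma compact_support_full P (K : set R) : measurable (K : set T) ->
  compact (msupport P) -> msupport P `<=` K ->
  exists A0 : R, forall A, A0 <= A -> P (K `&` `[- A, A]%classic) = 1%E.
Proof.
move=> mK /compact_bounded [M [_ bM]] sK; exists (M + 1) => A MA.
have mI : measurable (K `&` `[- A, A]%classic : set T).
  by apply: measurableI => //; exact: measurable_itv.
have sub : msupport P `<=` K `&` `[- A, A]%classic.
  move=> x sx; split; first exact: sK.
  have := bM (M + 1); rewrite ltrDl ltr01 => /(_ isT x sx) /= xM.
  by rewrite in_itv /= -ler_norml (le_trans xM).
have neg : P.-negligible (~` (K `&` `[- A, A]%classic)).
  apply: negligibleS (msupport_negligible P).
  exact: subsetC.
have P0 : P (~` (K `&` `[- A, A]%classic)) = 0%E.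
  by apply/negligibleP => //; exact: measurableC.
by rewrite -(setCK (_ `&` _)) probability_setC ?P0 ?sube0//; exact: measurableC.
Qed.

End Full.

Section Quantization.
Context {R : realType}.
Local Notation T := (measurableTypeR R).
Local Notation U := (uniform_prob (@ltr01 R)).
Variables (M : probability T R) (A c l : R).
Hypotheses (A_ge0 : 0 <= A) (c_gt0 : 0 < c) (l01 : 0 < l < 1).
Hypothesis MA : M `[- A, A]%classic = 1%E.
Hypothesis Mgap : forall x, 0 <= x < c -> M `]-oo, x]%classic = (1 - l)%:E.
Hypothesis Mmean : (\int[M]_x x%:E = 0)%E.

Let Q : T -> T := quantile M (- A).

Let Q_itv u : - A <= Q u <= A. Proof. exact: quantile_itv. Qed.

Let Q_le0 u : 0 < u <= 1 -> (Q u <= 0) = (u <= 1 - l).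
Proof. by move=> u01; rewrite (quantile_le MA)// Mgap ?lexx// lee_fin. Qed.

Let Q_clamp u : Q u = Q (Num.min (Num.max u 0) 1).
Proof.
have [u1|u1] := leP 1 u.
  rewrite /Q /quantile (max_l (le_trans ler01 u1)) !(min_r u1).
  by rewrite (min_l (lexx 1)).
have [u0|u0] := leP u 0; last by rewrite min_l// ltW.
by rewrite min_l ?ler01// /Q !(quantile_le0 MA).
Qed.

(** The distribution function equals 1 - l on all of [0, c[, so levels up to 1 - l are reached by 0
    and higher levels not before [c]. *)
Lemma quantile_gap u : Q u <= 0 \/ c <= Q u.
Proof.
have [u0|u0] := leP u 0.
  by left; rewrite /Q (quantile_le0 MA) ?oppr_le0.
rewrite Q_clamp; set v := Num.min _ _.
have v01 : 0 < v <= 1 by rewrite /v lt_min ge_min lexx orbT lt_max u0 ltr01.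
have [v1l|v1l] := leP v (1 - l); first by left; rewrite Q_le0.
right; rewrite leNgt; apply/negP => Qc.
have Mx : M `]-oo, (Num.max (Q v) 0)]%classic = (1 - l)%:E.
  by apply: Mgap; rewrite le_max lexx orbT gt_max Qc.
have := quantile_le MA (Num.max (Q v) 0) v01.
by rewrite Mx lee_fin [v <= _]leNgt v1l -/(Q v) le_max lexx.
Qed.

Let Q_homo : {homo Q : u v / u <= v}. Proof. exact: quantile_nondecreasing MA. Qed.

Let mQ : measurable_fun [set: T] Q. Proof. exact: measurable_quantile MA. Qed.

Let iQ : U.-integrable setT (EFin \o Q).
Proof.
apply: measurable_bounded_integrable => //.
  by rewrite (le_lt_trans (probability_le1 _ _)) ?ltry.
exists A; split; first exact: num_real.
move=> B AB u _ /=; apply: le_trans (ltW AB).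
by rewrite ler_norml Q_itv.
Qed.

Let meanQ : (\int[U]_u (Q u)%:E = 0)%E.
Proof.
pose qm : {mfun T >-> T} := @mfun_Sub _ _ T T Q (mem_set mQ).
have mE : measurable_fun [set: T] (EFin : T -> \bar R).
  exact: EFin_measurable.
rewrite -[RHS]Mmean -(@integral_distribution _ _ _ _ _ U qm (EFin : T -> \bar R))//.
by apply: eq_measure_integral => B mB _; exact: (quantile_pushforward MA).
Qed.

(* This is the ceiling of [l * n.+1]. *)
Definition quantization_rank (n : nat) : nat :=
  (n.+1 - Num.truncn ((1 - l) * n.+1%:R))%N.

(** Indices below the rank are those whose cell has its upper end above 1 - l, that is, a quantile
    beyond the gap. *)
Lemma quantization_rank_lt n (i : 'I_n.+1) :
  (i < quantization_rank n)%N = (i%:R < l * n.+1%:R).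
Proof.
have [l0 l1] : 0 < l /\ l < 1 by apply/andP.
have lN : 0 <= (1 - l) * n.+1%:R by rewrite mulr_ge0// subr_ge0 ltW.
rewrite /quantization_rank ltn_subRL addnC -ltn_subRL truncn_lt_nat//.
rewrite natrB; last exact: ltnW.
by rewrite mulrBl mul1r ltrD2l ltrN2.
Qed.

Lemma balanced_quantization n : (quantization_rank n <= n)%N ->
  exists y h : 'I_n.+1 -> R, [/\
    forall i : 'I_n.+1, (i < quantization_rank n)%N -> c <= y i <= A,
    forall i : 'I_n.+1, (quantization_rank n <= i)%N -> - (3 * A) <= y i <= 0,
    \sum_i y i = 0,
    forall u, `|y (unit_cell n u) - Q u| <= h (unit_cell n u) &
    \sum_i h i ^+ 2 <= (4 * A) ^+ 2].
Proof.
move=> Jn; set J := quantization_rank n.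
(* [q k] is the quantile at the upper end of cell [k], and [q k.+1] the one at its lower end. *)
pose q (k : nat) := Q (1 - k%:R / n.+1%:R).
have q_noninc k : q k.+1 <= q k.
  by apply: Q_homo; rewrite lerD2l lerN2 ler_pM2r ?invr_gt0 ?ltr0n// ler_nat.
have Qcell u : q (unit_cell n u).+1 <= Q u <= q (unit_cell n u).
  have /andP[u1 u2] := unit_cell_bounds n u.
  by rewrite Q_clamp !Q_homo.
have q_pos i : (i < J)%N -> (i < n.+1)%N -> c <= q i.
  move=> iJ iN; have := quantization_rank_lt (Ordinal iN); rewrite -/J iJ /=.
  move=> /esym il.
  have [|//] := quantile_gap (1 - i%:R / n.+1%:R).
  rewrite Q_le0; last first.
    by rewrite subr_gt0 ltr_pdivrMr ?ltr0n// mul1r ltr_nat iN gerBl divr_ge0.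
  by rewrite lerD2l lerN2 ler_pdivlMr ?ltr0n// leNgt il.
have q_neg i : (J <= i)%N -> (i < n.+1)%N -> q i <= 0.
  move=> iJ iN; have := quantization_rank_lt (Ordinal iN); rewrite -/J ltnNge iJ /=.
  move=> /esym.
  rewrite ltNge => /negbFE il.
  rewrite Q_le0; last first.
    by rewrite subr_gt0 ltr_pdivrMr ?ltr0n// mul1r ltr_nat iN gerBl divr_ge0.
  by rewrite lerD2l lerN2 ler_pdivlMr ?ltr0n// il.
(* The oscillations of Q over the cells telescope to Q 1 - Q 0, whatever the number of cells. *)
have sum_gap : \sum_(i < n.+1) (q i - q i.+1) <= 2 * A.
  rewrite -(big_mkord xpredT (fun i => q i - q i.+1)).
  have -> : \sum_(0 <= i < n.+1) (q i - q i.+1) = - q n.+1 - - q 0%N.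
    rewrite -(@telescope_sumr _ 0 n.+1 (fun i => - q i))//.
    by apply: eq_bigr => i _; ring.
  have /andP[_] := Q_itv (1 - 0%:R / n.+1%:R).
  have /andP[+ _] := Q_itv (1 - n.+1%:R / n.+1%:R).
  rewrite -/(q 0%N) -/(q n.+1); lra.
pose s := \sum_(i < n.+1) q i.
have iS (f : 'I_n.+1 -> R) : U.-integrable setT (fun u : T => (f (unit_cell n u))%:E).
  exact: (integrable_step U (@measurable_unit_cell R n)).
have eS (f : 'I_n.+1 -> R) :
    (\int[U]_u (f (unit_cell n u))%:E = (n.+1%:R^-1 * \sum_i f i)%:E)%E.
  exact: (integral_step (@measurable_unit_cell R n) (@uniform_unit_cell R n)).
(* Up to the factor 1 / N, [s] is the mean of a step function above Q, and Q has mean zero. *)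
have s_ge0 : 0 <= s.
  have : (\int[U]_u (Q u)%:E <= \int[U]_u (q (unit_cell n u))%:E)%E.
    apply: le_integral => //.
    - exact: (iS (fun i : 'I_n.+1 => q i)).
    - by move=> u _ /=; rewrite lee_fin; have /andP[] := Qcell u.
  rewrite meanQ (eS (fun i : 'I_n.+1 => q i)).
  by rewrite lee_fin pmulr_rge0 ?invr_gt0 ?ltr0n.
(* The lower step function has nonpositive mean, and the two sums differ by [sum_gap]. *)
have s_le : s <= 2 * A.
  have : (\int[U]_u (q (unit_cell n u).+1)%:E <= \int[U]_u (Q u)%:E)%E.
    apply: le_integral => //.
    - exact: (iS (fun i : 'I_n.+1 => q i.+1)).
    - by move=> u _ /=; rewrite lee_fin; have /andP[] := Qcell u.
  rewrite meanQ (eS (fun i : 'I_n.+1 => q i.+1)).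
  rewrite lee_fin pmulr_rle0 ?invr_gt0 ?ltr0n// => s'.
  apply: le_trans sum_gap; rewrite sumrB -/s; lra.
pose e (i : 'I_n.+1) := if i == ord_max then s else 0.
have e_ge0 i : 0 <= e i by rewrite /e; case: ifP.
have sum_e : \sum_i e i = s by rewrite /e -big_mkcond big_pred1_eq.
(* The error bound is the oscillation over the cell plus the correction. Subtracting at most 2A from
   a point that is at least -A explains the bound -3A. *)
exists (fun i : 'I_n.+1 => q i - e i), (fun i : 'I_n.+1 => q i - q i.+1 + e i); split.
(* The corrected point has index [n], which is at least the rank, so the points beyond the gap are
   untouched. *)
- move=> i iJ; rewrite /e ifF ?subr0 ?q_pos//=.
    by have /andP[] := Q_itv (1 - i%:R / n.+1%:R).
  by apply/negP => /eqP iE; move: iJ; rewrite iE /= ltnNge Jn.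
- move=> i iJ; have qi := q_neg i iJ (ltn_ord i).
  have /andP[qi' _] := Q_itv (1 - i%:R / n.+1%:R); rewrite -/(q i) in qi'.
  have ei : e i <= 2 * A by rewrite /e; case: ifP => // _; rewrite mulr_ge0.
  have ei0 := e_ge0 i; apply/andP; split; lra.
- by rewrite sumrB sum_e subrr.
- move=> u; have /andP[u1 u2] := Qcell u.
  rewrite ler_norml; have ei0 := e_ge0 (unit_cell n u); apply/andP; split; lra.
- pose h (i : 'I_n.+1) := q i - q i.+1 + e i.
  have h_ge0 i : 0 <= h i by rewrite addr_ge0// subr_ge0.
  have sum_h : \sum_i h i <= 4 * A by rewrite big_split /= sum_e; lra.
  have sum_h0 : 0 <= \sum_i h i by rewrite sumr_ge0.
  (* For nonnegative terms the sum of squares is at most the square of the sum; this keeps the bound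
     independent of [n]. *)
  apply: (@le_trans _ _ ((\sum_i h i) ^+ 2)); last first.
    by rewrite lerXn2r ?nnegrE// mulr_ge0.
  rewrite expr2 mulr_suml; apply: ler_sum => i _.
  by rewrite expr2 ler_wpM2l ?h_ge0// (bigD1 i)//= lerDl sumr_ge0.
Qed.

End Quantization.

(** * Nash equilibria of the quantized game *)

Section NashSums.
Context {R : realType}.

Lemma thresholdZ (a xi : R) : 0 < a -> threshold (a * xi) = threshold xi.
Proof. by move=> a0; rewrite /threshold pmulr_rlt0. Qed.

Lemma is_nash_of_sums (X : R -> R -> R -> R -> R) (t : R) N (x sigma : 'rV[R]_N) :
  (1 < N)%N ->
  (forall i, sigma 0 i = threshold
    (\sum_j X 0 t (sigma 0 j) (x 0 j) - X 0 t (sigma 0 i) (x 0 i))) ->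
  is_nash X t x sigma.
Proof.
move=> N1 H i; rewrite H sigma0_empirical.
set s := [seq _ | _ <- _ & _].
have s0 : (0 < size s)%N.
  have [j ji] : exists j : 'I_N, j != i.
    pose j0 := Ordinal (ltnW N1); pose j1 := Ordinal N1.
    have [e|] := eqVneq j0 i; last by exists j0.
    by exists j1; rewrite -e.
  rewrite size_map size_filter -has_count; apply/hasP; exists j => //.
  by rewrite mem_enum.
rewrite thresholdZ ?invr_gt0 ?ltr0n//; congr threshold.
rewrite big_map big_filter big_enum_cond /=.
by rewrite [X in X - _](bigD1 i)//= addrAC subrr add0r.
Qed.

Lemma sum_ord_lt N J (a : R) : (J <= N)%N ->
  \sum_(i < N) (if (i < J)%N then a else 0) = J%:R * a.
Proof.
move=> JN; rewrite -big_mkcond -(big_ord_widen _ (fun=> a) JN).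
by rewrite sumr_const card_ord mulr_natl.
Qed.

Lemma lipschitz_continuous (f : R -> R) (E : R) :
  (forall x y, `|f x - f y| <= E * `|x - y|) -> continuous f.
Proof.
move=> lip x; apply/cvgrPdist_le => /= e e0.
have E0 : 0 < `|E| + 1 by rewrite ltr_pwDr.
near=> y; apply: le_trans (lip x y) _.
apply: (@le_trans _ _ ((`|E| + 1) * `|x - y|)).
  by rewrite ler_wpM2r// (le_trans (ler_norm E))// lerDl.
rewrite -ler_pdivlMl//; near: y.
exists ((`|E| + 1)^-1 * e) => /=; first by rewrite mulr_gt0 ?invr_gt0.
by move=> y /= /ltW.
Unshelve. all: by end_near.
Qed.

Lemma continuous_gt0_segment (f : R -> R) (a b : R) :
  continuous f -> (forall x, 0 < f x) ->
  exists2 delta : R, 0 < delta & forall x, a <= x <= b -> delta <= f x.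
Proof.
move=> cf f0; have [ab|ba] := leP a b; last first.
  by exists 1 => // x /andP[ax xb]; move: (le_trans ax xb); rewrite leNgt ba.
have [c _ minc] := EVT_min ab (continuous_subspaceT cf).
by exists (f c) => // x xab; apply: minc; rewrite in_itv.
Qed.

End NashSums.

(** * The flow switched across the gap *)

Section Flows.
Context {R : realType} (X : R -> R -> R -> R -> R) (t : R).
Local Notation T := (measurableTypeR R).
Variables (E D c : R).
Hypothesis c_gt0 : 0 < c.
Hypothesis lipX : forall sigma x y, sigma = 0 \/ sigma = 1 ->
  `|X t 0 sigma x - X t 0 sigma y| <= E * `|x - y|.
Hypothesis dispX : forall sigma x, sigma = 0 \/ sigma = 1 ->
  `|X t 0 sigma x - x| <= D.

Let measurable_flow sigma : sigma = 0 \/ sigma = 1 ->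
  measurable_fun [set: T] (X t 0 sigma : T -> T).
Proof.
move=> hs; apply: continuous_measurable_fun.
by apply: (@lipschitz_continuous _ _ E) => x y; exact: lipX.
Qed.

(** This is the map Phi. *)
Definition switched_flow (y : T) : T := if y <= 0 then X t 0 0 y else X t 0 1 y.

Lemma measurable_switched_flow : measurable_fun [set: T] switched_flow.
Proof.
apply: measurable_fun_ifT => //=;
  [|by apply: measurable_flow; left|by apply: measurable_flow; right].
exact: measurable_fun_ler.
Qed.

(* Across the gap ]0, c[ the displacement [2 * D] is absorbed by
   [2 * D / c * (y - x)]. *)
Lemma switched_flow_lipschitz x y : x <= 0 \/ c <= x -> y <= 0 \/ c <= y ->
  `|switched_flow x - switched_flow y| <= (E + 2 * D / c) * `|x - y|.
Proof.
have D0 : 0 <= D by apply: le_trans (dispX 0 (or_introl erefl)).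
have DC0 : 0 <= 2 * D / c by rewrite divr_ge0 ?mulr_ge0// ltW.
wlog xy : x y / x <= y => [H hx hy|].
  have [xy|/ltW yx] := leP x y; first exact: H.
  by rewrite distrC [`|x - y|]distrC; apply: H.
move=> hx hy; rewrite /switched_flow.
have [x0|x0] := leP x 0; have [y0|y0] := leP y 0.
- by apply: le_trans (lipX _ _ (or_introl erefl)) _; rewrite ler_wpM2r// lerDl.
- have cy : c <= y by case: hy => //; rewrite leNgt y0.
  have cxy : c <= `|x - y| by rewrite distrC ger0_norm ?subr_ge0//; lra.
  rewrite mulrDl.
  have -> : X t 0 0 x - X t 0 1 y =
    (X t 0 0 x - X t 0 0 y) + ((X t 0 0 y - y) - (X t 0 1 y - y)) by ring.
  apply: le_trans (ler_normD _ _) _; apply: lerD; first by apply: lipX; left.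
  apply: le_trans (ler_normB _ _) _.
  apply: (@le_trans _ _ (2 * D)).
    by rewrite mulr_natl mulr2n lerD//; apply: dispX; [left|right].
  by rewrite mulrAC ler_pdivlMr// ler_wpM2l ?mulr_ge0.
- by move: (le_trans xy y0); rewrite leNgt x0.
- by apply: le_trans (lipX _ _ (or_intror erefl)) _; rewrite ler_wpM2r// lerDl.
Qed.

Lemma switched_flow_displacement y : `|switched_flow y - y| <= D.
Proof. by rewrite /switched_flow; case: ifP => _; apply: dispX; [left|right]. Qed.

(** [tmu] is carried by the half-line where Phi is the flow with parameter 0, [tnu] by the one where
    it is the flow with parameter 1. *)
Lemma mix_pushforward_switched (l : R) (tmu tnu : probability T R) (A : set T) :
  tmu `]-oo, 0]%classic = 1%E -> tnu `]0, +oo[%classic = 1%E -> measurable A ->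
  mix l (pushforward tmu (X t 0 0)) (pushforward tnu (X t 0 1)) A =
  mix l tmu tnu (switched_flow @^-1` A).
Proof.
move=> tmu0 tnu0 mA.
have m0 : measurable (X t 0 0 @^-1` A : set T).
  by have := measurable_flow (or_introl erefl) measurableT mA; rewrite setTI.
have m1 : measurable (X t 0 1 @^-1` A : set T).
  by have := measurable_flow (or_intror erefl) measurableT mA; rewrite setTI.
have ms : measurable (switched_flow @^-1` A : set T).
  by have := measurable_switched_flow measurableT mA; rewrite setTI.
rewrite /mix /pushforward; congr (_ * _ + _ * _)%E.
  rewrite -(probability_setI_full m0 (measurable_itv _) tmu0).
  rewrite -(probability_setI_full ms (measurable_itv _) tmu0).
  congr (tmu _); apply/seteqP.
  by split => y /=; rewrite in_itv /= /switched_flow => -[+ y0]; rewrite y0.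
rewrite -(probability_setI_full m1 (measurable_itv _) tnu0).
rewrite -(probability_setI_full ms (measurable_itv _) tnu0).
congr (tnu _); apply/seteqP.
by split => y /=; rewrite in_itv /= andbT /switched_flow => -[+ y0]; rewrite leNgt y0.
Qed.

End Flows.

(** * The three equilibrium profiles *)

Section Equilibria.
Context {R : realType} (X : R -> R -> R -> R -> R) (t : R).
Variables (B D c delta : R) (N J : nat) (y : 'I_N -> R).
Hypotheses (c_gt0 : 0 < c) (J_gt1 : (1 < J)%N) (JN : (J < N)%N).
Hypothesis invX : forall sigma x, sigma = 0 \/ sigma = 1 ->
  X 0 t sigma (X t 0 sigma x) = x.
Hypothesis dispX : forall sigma x, sigma = 0 \/ sigma = 1 ->
  `|X t 0 sigma x - x| <= D /\ `|X 0 t sigma x - x| <= D.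
Hypothesis gap0 : forall x, - B <= x <= B -> delta <= X 0 t 0 (X t 0 1 x) - x.
Hypothesis gap1 : forall x, - B <= x <= B -> delta <= x - X 0 t 1 (X t 0 0 x).
Hypothesis y_hi : forall i : 'I_N, (i < J)%N -> c <= y i <= B.
Hypothesis y_lo : forall i : 'I_N, (J <= i)%N -> - B <= y i <= 0.
Hypothesis sum_y : \sum_i y i = 0.
Hypothesis J_large : B + 2 * D <= J%:R * delta.
Hypothesis NJ_large : B + 2 * D < (N - J)%N%:R * delta.

Let x : 'rV[R]_N := \row_i switched_flow X t (y i).

Let N_gt1 : (1 < N)%N. Proof. exact: ltn_trans J_gt1 JN. Qed.

Let switched_hi (i : 'I_N) : (i < J)%N -> switched_flow X t (y i) = X t 0 1 (y i).
Proof.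
move=> /y_hi /andP[cy _]; rewrite /switched_flow ifF//.
by apply/negbTE; rewrite -ltNge; exact: lt_le_trans cy.
Qed.

Let switched_lo (i : 'I_N) : (J <= i)%N -> switched_flow X t (y i) = X t 0 0 (y i).
Proof. by move=> /y_lo /andP[_ y0]; rewrite /switched_flow y0. Qed.

Let y_itv i : - B <= y i <= B.
Proof.
have [iJ|Ji] := ltnP i J.
  have c0 := c_gt0; have /andP[cy yB] := y_hi iJ; apply/andP; split; lra.
have /andP[By y0] := y_lo Ji; apply/andP; split; lra.
Qed.

(** Going forward and going back each displace a point by at most D; this bounds the omitted term
    independently of N. *)
Let back_bound sigma (i : 'I_N) : sigma = 0 \/ sigma = 1 ->
  `|X 0 t sigma (switched_flow X t (y i))| <= B + 2 * D.
Proof.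
move=> hs; set z := switched_flow X t (y i).
have zy : `|z - y i| <= D.
  apply: switched_flow_displacement => s w hs'; exact: (dispX w hs').1.
have zz := (dispX z hs).2.
have := y_itv i; rewrite -ler_norml => yB.
have -> : X 0 t sigma z = (X 0 t sigma z - z) + (z - y i) + y i by ring.
apply: le_trans (ler_normD _ _) _; apply: le_trans (lerD (ler_normD _ _) yB) _; lra.
Qed.

(** The first J points come back at least [delta] to the right of [y j], the others exactly at
    [y j]. The gain J * delta outweighs the omitted term, so the remaining sum is nonnegative. *)
Lemma is_nash_const0 : is_nash X t x (const_mx 0).
Proof.
apply: is_nash_of_sums => // i; rewrite !mxE /threshold ifF//; apply/negbTE.
rewrite -leNgt subr_ge0.
have := ler_normlW (back_bound i (or_introl erefl)) => /le_trans; apply.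
apply: (le_trans J_large).
(* The [y j] sum to zero, so adding them to the gains leaves the total unchanged and allows a
   termwise comparison. *)
have -> : J%:R * delta = \sum_(j < N) ((if (j < J)%N then delta else 0) + y j).
  by rewrite big_split /= sum_y addr0 sum_ord_lt// ltnW.
apply: ler_sum => j _; rewrite !mxE; have [jJ|Jj] := ltnP j J.
  by rewrite switched_hi// -lerBrDr gap0.
by rewrite add0r switched_lo// invX//; left.
Qed.

(** Now the last N - J points come back at least [delta] to the left. The remaining sum must be
    strictly negative, as the threshold is 0 at 0; hence the strict inequality in [NJ_large]. *)
Lemma is_nash_const1 : is_nash X t x (const_mx 1).
Proof.
apply: is_nash_of_sums => // i; rewrite !mxE /threshold ifT//.
rewrite subr_lt0.
have /lerNnormlW := back_bound i (or_intror erefl); apply: lt_le_trans.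
rewrite ltrNr; apply: (lt_le_trans NJ_large).
rewrite natrB; last exact: ltnW.
have -> : (N%:R - J%:R) * delta =
    \sum_(j < N) (delta - (if (j < J)%N then delta else 0)) - \sum_j y j.
  rewrite sum_y subr0 sumrB (sum_ord_lt delta (ltnW JN)) sumr_const card_ord mulrBl.
  by rewrite [N%:R * _]mulr_natl.
rewrite -sumrB -sumrN; apply: ler_sum => j _; rewrite !mxE; have [jJ|Jj] := ltnP j J.
  by rewrite subrr sub0r switched_hi// invX//; right.
by rewrite subr0 switched_lo//; have := gap1 (y_itv j); lra.
Qed.

(** Every point is sent back by the flow that brought it forward. A value [y i = 0] with [J <= i] is
    consistent, since the threshold vanishes at 0. *)
Lemma is_nash_switch : is_nash X t x (\row_(i < N) (if (i < J)%N then 1 else 0)).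
Proof.
have back j : X 0 t ((\row_(i < N) (if (i < J)%N then 1 else 0)) 0 j) (x 0 j) = y j.
  rewrite !mxE; have [jJ|Jj] := ltnP j J.
    by rewrite switched_hi// invX//; right.
  by rewrite switched_lo// invX//; left.
apply: is_nash_of_sums => // i; rewrite back.
under eq_bigr do rewrite back.
rewrite sum_y sub0r mxE /threshold oppr_lt0; have [iJ|Ji] := ltnP i J.
  by have /andP[cy _] := y_hi iJ; rewrite (lt_le_trans c_gt0 cy).
by have /andP[_ y0] := y_lo Ji; rewrite ltNge y0.
Qed.

(** Coordinate 0 separates the null profile from the other two, and coordinate J separates those
    from each other. *)
Lemma uniq_equilibria : uniq [:: const_mx 0 : 'rV[R]_N; const_mx 1;
  \row_(i < N) (if (i < J)%N then 1 else 0)].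
Proof.
have lt0N : (0 < N)%N by exact: ltnW.
rewrite /= !inE negb_or !andbT -andbA; apply/and3P; split; apply/eqP => /rowP.
- by move=> /(_ (Ordinal lt0N)); rewrite !mxE => /esym/eqP; rewrite oner_eq0.
- move=> /(_ (Ordinal lt0N)); rewrite !mxE /= (ltnW J_gt1) => /esym/eqP.
  by rewrite oner_eq0.
- by move=> /(_ (Ordinal JN)); rewrite !mxE /= ltnn => /eqP; rewrite oner_eq0.
Qed.

End Equilibria.

(** * Asymptotics *)

Section Asymptotics.
Context {R : realType}.

Lemma quantization_rank_bounds (l : R) n : 0 < l < 1 ->
  l * n.+1%:R <= (quantization_rank l n)%:R < l * n.+1%:R + 1.
Proof.
move=> /andP[l0 l1].
have lN : 0 <= (1 - l) * n.+1%:R by rewrite mulr_ge0// subr_ge0 ltW.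
have /andP[t1 t2] := truncn_itv lN.
rewrite /quantization_rank natrB; last first.
  rewrite -(ler_nat R); apply: (le_trans t1).
  by rewrite ler_piMl// gerBl ltW.
move: t1 t2; rewrite -natr1 mulrBl mul1r; set a := (Num.truncn _)%:R => t1 t2.
by apply/andP; split; lra.
Qed.

Lemma cvg_shifted_harmonic k0 : (((n + k0).+1%:R)^-1 : R) @[n --> \oo] --> (0 : R).
Proof. by have := @cvg_harmonic R; rewrite -(cvg_shiftn k0). Qed.

Lemma W2_cvg0 (mus : nat -> set (measurableTypeR R) -> \bar R) m (K : R) k0 :
  (forall k, (W2 (mus k) m <= (Num.sqrt ((k + k0).+1%:R^-1 * K))%:E)%E) ->
  W2 (mus k) m @[k --> \oo] --> 0%E.
Proof.
move=> H; apply: (@squeeze_cvge _ _ _ _ (fun=> 0%E) _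
    (fun k => (Num.sqrt ((k + k0).+1%:R^-1 * K))%:E)).
- by apply: nearW => k; rewrite H andbT; exact: poweR_ge0.
- exact: cvg_cst.
- apply: cvg_EFin; first exact: nearW.
  have h : (k + k0).+1%:R^-1 * K @[k --> \oo] --> (0 : R).
    by rewrite -(mul0r K); apply: cvgMr_tmp; exact: cvg_shifted_harmonic.
  have := cvg_comp _ _ h (@sqrt_continuous R 0).
  by rewrite sqrtr0.
Qed.

Lemma quantization_rank_cvg (l : R) k0 : 0 < l < 1 ->
  (quantization_rank l (k + k0))%:R / (k + k0).+1%:R @[k --> \oo] --> l.
Proof.
move=> l01; apply: (@squeeze_cvgr _ _ _ _ (fun=> l) (fun k => l + (k + k0).+1%:R^-1)).
- apply: nearW => k; have /andP[J1 J2] := quantization_rank_bounds (k + k0) l01.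
  rewrite ler_pdivlMr ?ltr0n// J1 ler_pdivrMr ?ltr0n// mulrDl mulVf ?pnatr_eq0//.
  exact: ltW.
- exact: cvg_cst.
- have h : l + (k + k0).+1%:R^-1 @[k --> \oo] --> l + 0.
    by apply: cvgD; [exact: cvg_cst|exact: cvg_shifted_harmonic].
  by rewrite addr0 in h.
Qed.

End Asymptotics.

(** * Choice of the sequence and conclusion *)

Theorem proposition2p12 (R : realType) (lo hi : \bar R)
  (b : R -> R -> R -> R) (X : R -> R -> R -> R -> R)
  (h01 : [set s : R | 0 <= s <= 1] `<=` oitv lo hi)
  (hB : assumptionB lo hi b)
  (hinc : forall t s x : R, 0 <= t -> oitv lo hi s -> 0 < Dsigma b t s x)
  (hX : is_flow lo hi b X)
  (t : R) (ht : 0 < t)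
  (tmu tnu : probability (measurableTypeR R) R)
  (hcmu : compact (msupport tmu)) (hcnu : compact (msupport tnu))
  (hsmu : msupport tmu `<=` [set x : R | x <= 0])
  (c : R) (hc : 0 < c)
  (hsnu : msupport tnu `<=` [set x : R | c <= x])
  (hmean : (\int[tmu]_x x%:E < 0)%E)
  (lam : R) (hlam : 0 < lam < 1)
  (hbal : (\int[mix lam tmu tnu]_x x%:E = 0)%E) :
  let mu : set (measurableTypeR R) -> \bar R := pushforward tmu (X t 0 0) in
  let nu : set (measurableTypeR R) -> \bar R := pushforward tnu (X t 0 1) in
  let m := mix lam mu nu in
  exists (N J : nat -> nat) (x : forall k : nat, 'rV[R]_(N k)),
    [/\ N k @[k --> \oo] --> \oo,
        W2 (empirical [seq x k 0 j | j <- enum 'I_(N k)]) m @[k --> \oo]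
          --> 0%E,
        forall k, (1 < J k < N k)%N,
        (J k)%:R / (N k)%:R @[k --> \oo] --> lam &
        forall k,
          let sigma1 : 'rV[R]_(N k) := const_mx 0 in
          let sigma2 : 'rV[R]_(N k) := const_mx 1 in
          let sigma3 : 'rV[R]_(N k) :=
            \row_(i < N k) (if (i < J k)%N then 1 else 0) in
          [/\ uniq [:: sigma1; sigma2; sigma3],
              is_nash X t (x k) sigma1,
              is_nash X t (x k) sigma2 &
              is_nash X t (x k) sigma3]].
Proof.
move=> mu nu m.
have s01 sigma : sigma = 0 \/ sigma = 1 -> oitv lo hi sigma.
  by case=> ->; apply: h01; rewrite /= ?lexx ?ler01.
have [E [E0 lipX]] := flow_lipschitz hB hX ht.
have [D dispX] := flow_displacement hB hX ht.
have D0 : 0 <= D by apply: le_trans (dispX 0 0 (s01 0 (or_introl erefl))).1.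
have [A1 full1] := compact_support_full (measurable_itv `]-oo, 0]) hcmu hsmu.
have hsnu' : msupport tnu `<=` `[c, +oo[%classic.
  move=> y /hsnu cy; rewrite /= in_itv. by rewrite /= cy.
have [A2 full2] := compact_support_full (measurable_itv `[c, +oo[) hcnu hsnu'.
(* A common nonnegative radius for both supports. *)
pose A := Num.max 0 (Num.max A1 A2).
have A0 : 0 <= A by rewrite le_max lexx.
have Pmu := full1 A; rewrite !le_max lexx orbT in Pmu; move/(_ isT) in Pmu.
have Pnu := full2 A; rewrite !le_max lexx !orbT in Pnu; move/(_ isT) in Pnu.
have [lam0 lam1] : 0 < lam /\ lam < 1 by apply/andP.
have mitv (i : interval R) : measurable ([set` i] : set (measurableTypeR R)).
  exact: measurable_itv.
have mmu := measurableI _ _ (mitv `]-oo, 0]) (mitv `[(- A), A]).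
have mnu := measurableI _ _ (mitv `[c, +oo[) (mitv `[(- A), A]).
have lam01 : 0 <= lam <= 1 by rewrite !ltW.
have [M ME] := mix_probability tmu tnu lam01.
have MA : M `[- A, A]%classic = 1%E.
  rewrite ME /mix (probability_full_sub mmu (mitv _) Pmu (@subIsetr _ _ _)).
  rewrite (probability_full_sub mnu (mitv _) Pnu (@subIsetr _ _ _)).
  by rewrite !mule1 -EFinD subrK.
have Mgap y : 0 <= y < c -> M `]-oo, y]%classic = (1 - lam)%:E.
  move=> /andP[y0 yc]; rewrite ME /mix (probability_full_sub mmu (mitv _) Pmu).
    rewrite (probability_full_disjoint mnu (mitv _) Pnu).
      by rewrite mule1 mule0 adde0.
    move=> z [cz _] zy; move: cz zy; rewrite /= !in_itv /= => /andP[cz _] zy.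
    by have := lt_le_trans yc (le_trans cz zy); rewrite ltxx.
  by move=> z [z0 _]; move: z0; rewrite /= !in_itv /= => z0; exact: le_trans z0 y0.
have Mmean : (\int[M]_x x%:E = 0)%E by rewrite -ME in hbal.
have cback sigma tau : sigma = 0 \/ sigma = 1 -> tau = 0 \/ tau = 1 ->
    continuous (fun y => X 0 t sigma (X t 0 tau y)).
  move=> hs htau; apply: (@lipschitz_continuous _ _ (E * E)) => u v.
  apply: le_trans (lipX _ _ _ (s01 _ hs)).2 _.
  by rewrite -mulrA ler_wpM2l//; exact: (lipX _ _ _ (s01 _ htau)).1.
(* The segment [-3A, 3A] contains every point produced by the quantization. *)
have [delta0 d00 gap0] : exists2 delta : R, 0 < delta &
    forall y, - (3 * A) <= y <= 3 * A -> delta <= X 0 t 0 (X t 0 1 y) - y.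
  apply: continuous_gt0_segment => [|y]; last first.
    by rewrite subr_gt0; exact: (flow_back0_gt hB hX ht h01 hinc).
  move=> y; apply: cvgB; last exact: cvg_id.
  by apply: cback; [left|right].
have [delta1 d10 gap1] : exists2 delta : R, 0 < delta &
    forall y, - (3 * A) <= y <= 3 * A -> delta <= y - X 0 t 1 (X t 0 0 y).
  apply: continuous_gt0_segment => [|y]; last first.
    by rewrite subr_gt0; exact: (flow_back1_lt hB hX ht h01 hinc).
  move=> y; apply: cvgB; first exact: cvg_id.
  by apply: cback; [right|left].
pose delta := Num.min delta0 delta1.
have dlt0 : 0 < delta by rewrite lt_min d00.
(* With C = 3A + 2D, both J and N - J must exceed C / delta. The summand 2 gives J > 1 and absorbs
   the rounding of lam * N up to J, leaving at least 1 to spare. *)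
pose b0 : R := 2 + (3 * A + 2 * D) / delta.
have b00 : 0 < b0 by rewrite ltr_wpDr// divr_ge0 ?addr_ge0 ?mulr_ge0// ltW.
(* The sum of the two quotients dominates each of them, so both [lam * N] and [(1 - lam) * N] are at
   least [b0] from the first game on. *)
pose k0 := Num.truncn (b0 / lam + b0 / (1 - lam)).
have Nlarge k : b0 <= lam * (k + k0).+1%:R /\ b0 <= (1 - lam) * (k + k0).+1%:R.
  have l10 : 0 < 1 - lam by rewrite subr_gt0.
  have k0le : b0 / lam + b0 / (1 - lam) <= (k + k0).+1%:R.
    by apply: le_trans (ltW (truncnS_gt _)) _; rewrite ler_nat ltnS leq_addl.
  have p1 : 0 <= b0 / lam by rewrite divr_ge0// ltW.
  have p2 : 0 <= b0 / (1 - lam) by rewrite divr_ge0// ltW.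
  by split; rewrite mulrC -ler_pdivrMr//; apply: le_trans k0le; rewrite ?lerDl ?lerDr.
pose J k := quantization_rank lam (k + k0).
have J_bounds k := quantization_rank_bounds (k + k0) hlam.
have C0 : 0 <= (3 * A + 2 * D) / delta by rewrite divr_ge0 ?addr_ge0 ?mulr_ge0// ltW.
have J_gt1 k : (1 < J k)%N.
  rewrite -(ltr_nat R); have /andP[J1 _] := J_bounds k.
  have [N1 _] := Nlarge k; apply: lt_le_trans J1; apply: lt_le_trans N1.
  rewrite /b0; lra.
have JN_real k : (J k)%:R + (1 + (3 * A + 2 * D) / delta) < (k + k0).+1%:R.
  have /andP[_ J2] := J_bounds k; have [_ N2] := Nlarge k.
  rewrite mulrBl mul1r /b0 in N2; rewrite /J; lra.
have JN k : (J k < (k + k0).+1)%N.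
  by rewrite -(ltr_nat R); apply: le_lt_trans (JN_real k); rewrite lerDl addr_ge0.
have Y k := cid (balanced_quantization A0 hc hlam MA Mgap Mmean (JN k)).
pose y k := projT1 (Y k).
have yP k := projT2 (Y k); rewrite -/(y _) in yP.
have lipX' sigma u v : sigma = 0 \/ sigma = 1 ->
    `|X t 0 sigma u - X t 0 sigma v| <= E * `|u - v|.
  by move=> hs; have [] := lipX sigma u v (s01 _ hs).
have dispX' sigma u : sigma = 0 \/ sigma = 1 -> `|X t 0 sigma u - u| <= D.
  by move=> hs; have [] := dispX sigma u (s01 _ hs).
exists (fun k => (k + k0).+1), J, (fun k => \row_i switched_flow X t (y k i)).
split.
- apply/cvgnyPge => K; near=> k.
  by rewrite (@leq_trans k)//; [near: k; exact: nbhs_infty_ge|rewrite -addnS leq_addr].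
- pose L := E + 2 * D / c.
  have L0 : 0 <= L by rewrite addr_ge0// divr_ge0 ?mulr_ge0// ltW.
  apply: (@W2_cvg0 _ _ _ ((L * (4 * A)) ^+ 2) k0) => k.
  rewrite (_ : [seq _ | _ <- _] =
      [seq switched_flow X t (y k i) | i <- enum 'I_(k + k0).+1]); last first.
    by apply: eq_map => i; rewrite mxE.
  have [h [yhi ylo ysum yh hsum]] := yP k.
  (* Z is Phi composed with the quantile function of M, so it carries the uniform law to [m]. *)
  pose Z (u : measurableTypeR R) := switched_flow X t (quantile M (- A) u).
  have msf := measurable_switched_flow lipX'.
  have mZ : measurable_fun setT Z.
    by apply: measurableT_comp => //; exact: (measurable_quantile MA).
  have mE (B : set (measurableTypeR R)) : measurable B ->
      m B = uniform_prob (@ltr01 R) (Z @^-1` B).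
    move=> mB.
    have mB' : measurable (switched_flow X t @^-1` B : set (measurableTypeR R)).
      by have := msf measurableT B mB; rewrite setTI.
    apply: etrans (esym (quantile_pushforward MA mB')).
    rewrite ME; apply: (mix_pushforward_switched lipX') => //.
      exact: probability_full_sub mmu (mitv _) Pmu (@subIsetl _ _ _).
    apply: probability_full_sub mnu (mitv _) Pnu _ => z [cz _]; move: cz.
    by rewrite /= !in_itv /= !andbT; exact: lt_le_trans.
  have gap u : `|switched_flow X t (y k (unit_cell (k + k0) u)) - Z u| <=
      L * h (unit_cell (k + k0) u).
    apply: le_trans (ler_wpM2l L0 (yh u)).
    apply: (switched_flow_lipschitz hc lipX' dispX');
      last exact: (quantile_gap A0 hc MA Mgap).
    have [iJ|Ji] := ltnP (unit_cell (k + k0) u) (J k).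
      by right; have /andP[] := yhi _ iJ.
    by left; have /andP[] := ylo _ Ji.
  apply: le_trans (W2_empirical_le (@measurable_unit_cell R (k + k0))
    (@uniform_unit_cell R (k + k0)) mZ mE (g := fun i => L * h i) gap) _.
  rewrite lee_fin ler_wsqrtr// ler_wpM2l ?invr_ge0//.
  under eq_bigr do rewrite exprMn.
  by rewrite -mulr_sumr exprMn ler_wpM2l ?sqr_ge0.
- by move=> k; rewrite J_gt1 JN.
- exact: quantization_rank_cvg.
- move=> k; have [h [yhi ylo ysum _ _]] := yP k.
  have invX sigma u : sigma = 0 \/ sigma = 1 -> X 0 t sigma (X t 0 sigma u) = u.
    by move=> hs; exact: (flow_inverse hB hX ht u (s01 _ hs)).
  have dispX2 sigma u : sigma = 0 \/ sigma = 1 ->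
      `|X t 0 sigma u - u| <= D /\ `|X 0 t sigma u - u| <= D.
    by move=> hs; exact: dispX _ u (s01 _ hs).
  have gap0' u : - (3 * A) <= u <= 3 * A -> delta <= X 0 t 0 (X t 0 1 u) - u.
    by move=> /gap0; apply: le_trans; rewrite ge_min lexx.
  have gap1' u : - (3 * A) <= u <= 3 * A -> delta <= u - X 0 t 1 (X t 0 0 u).
    by move=> /gap1; apply: le_trans; rewrite ge_min lexx orbT.
  have yhi' (i : 'I_(k + k0).+1) : (i < J k)%N -> c <= y k i <= 3 * A.
    by move=> /yhi /andP[-> yA] /=; apply: (le_trans yA); rewrite ler_peMl// ler1n.
  have C_le (r : R) : 1 + (3 * A + 2 * D) / delta < r -> 3 * A + 2 * D < r * delta.
    by rewrite -ltr_pdivrMr//; lra.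
  have Jd : 3 * A + 2 * D <= (J k)%:R * delta.
    apply/ltW/C_le; have /andP[J1 _] := J_bounds k.
    have [N1 _] := Nlarge k; rewrite /J; rewrite /b0 in N1; lra.
  have NJd : 3 * A + 2 * D < ((k + k0).+1 - J k)%N%:R * delta.
    by apply: C_le; rewrite natrB; [have := JN_real k; lra|exact: ltnW].
  split.
  + exact: uniq_equilibria.
  + exact: (is_nash_const0 hc (J_gt1 k) (JN k) invX dispX2 gap0' yhi' ylo ysum Jd).
  + exact: (is_nash_const1 hc (J_gt1 k) (JN k) invX dispX2 gap1' yhi' ylo ysum NJd).
  + exact: (is_nash_switch hc (J_gt1 k) (JN k) invX yhi' ylo ysum).
Unshelve. all: by end_near.
Qed.
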